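(* Let $\varphi:\mathbb{B}\times\mathrm{Sp}(1)\to\mathcal{M}(\mathbb{B})$ be the map that assigns to every $(a,u)\in\mathbb{B}\times\mathrm{Sp}(1)$ the slice regular M\''obius transformation $$q\mapsto(1-q\overline{a})^{-*}*(q-a)u .$$ Then $\varphi$ is a diffeomorphism for the manifold structure on $\mathcal{M}(\mathbb{B})$ for which the bijection $\mathrm{Sp}(1,1)/\mathrm{Sp}(1)I_2\to\mathcal{M}(\mathbb{B})$, $A\,\mathrm{Sp}(1)I_2\mapsto\mathcal{F}_{A^{-1}}$, is a diffeomorphism. In particular, $\mathcal{M}(\mathbb{B})$ is diffeomorphic to $\mathbb{R}^4\times S^3$, where $S^3$ denotes the $3$-dimensional sphere.
   Context: $\mathbb{H}$ denotes the quaternions and $\mathbb{B}=\{q\in\mathbb{H}: |q|<1\}$. $\mathrm{Sp}(1,1)=\{A\in M_2(\mathbb{H}): A^*I_{1,1}A=I_{1,1}\}$ with $I_{1,1}=\operatorname{diag}(1,-1)$, a Lie group. $\mathrm{Sp}(1)=\{q\in\mathbb{H}:|q|=1\}$, and $\mathrm{Sp}(1)I_2=\{uI_2:u\in\mathrm{Sp}(1)\}$, a closed subgroup of $\mathrm{Sp}(1,1)$. The coset space $\mathrm{Sp}(1,1)/\mathrm{Sp}(1)I_2$ carries the unique manifold structure for which the quotient map from $\mathrm{Sp}(1,1)$ is a submersion. A function $f:\mathbb{B}\to\mathbb{H}$ is (left) slice regular if for every $I\in\mathbb{H}$ with $I^2=-1$ one has $\frac12\left(\frac{\partial}{\partial x}+I\frac{\partial}{\partial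 y}\right)f(x+Iy)=0$ whenever $x,y\in\mathbb{R}$, $x+yI\in\mathbb{B}$. Such functions have power series expansions $f(q)=\sum_n q^na_n$ on $\mathbb{B}$. For $f(q)=\sum q^na_n$ and $g(q)=\sum q^nb_n$, the $*$-product is $(f*g)(q)=\sum_n q^n\sum_{k=0}^n a_kb_{n-k}$; the regular conjugate is $f^c(q)=\sum q^n\overline{a_n}$; the symmetrization is $f^s=f*f^c$; the $*$-reciprocal is $f^{-*}(q)=f^s(q)^{-1}f^c(q)$ off the zero set of $f^s$. For $a,b\in\mathbb{H}$ let $l_{(a,b)}(q)=qa+b$. For $A=\begin{pmatrix}a&c\\ b&d\end{pmatrix}\in\mathrm{Sp}(1,1)$, the slice regular M\''obius transformation $\mathcal{F}_A:\mathbb{B}\to\mathbb{B}$ is $\mathcal{F}_A=l_{(c,d)}^{-*}*l_{(a,b)}$, written $\mathcal{F}_A(q)=(qc+d)^{-*}*(qa+b)$. Set $\mathcal{M}(\mathbb{B})=\{\mathcal{F}_A:A\in\mathrm{Sp}(1,1)\}$. (Each $\mathcal{F}_A$ is a well defined slice regular bijection of $\mathbb{B}$ onto itself.) The notation $(1-q\overline{a})^{-*}*(q-a)u$ means $l_{(-\overline{a},1)}^{-*}*l_{(u,-au)}$. It is known that $\varphi$ is a bijection of sets. *)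

(* Defs.v *)
From HB Require Import structures.
From mathcomp Require Import all_boot all_order all_algebra.
From mathcomp Require Import all_classical all_reals all_analysis.
From mathcomp Require Import ring.
Import Order.TTheory GRing.Theory Num.Theory.
Import numFieldNormedType.Exports.

Set Implicit Arguments.
Unset Strict Implicit.
Unset Printing Implicit Defensive.

Local Open Scope classical_set_scope.
Local Open Scope ring_scope.

(* x0 + x1 i + x2 j + x3 k is the row vector (x0, x1, x2, x3), from which the
   quaternions inherit their topology.  The library norm `|q| is then the sup
   norm of the coordinates; the quaternionic modulus is [qnorm]. *)
Definition quat (R : realType) := 'rV[R]_4.

HB.instance Definition _ (R : realType) :=
  NormedModule.copy (quat R) 'rV[R]_4.

Section Quaternions.
Context {R : realType}.
Implicit Types p q r : quat R.

Definition mkquat (x0 x1 x2 x3 : R) : quat R :=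
  \row_(i < 4) [:: x0; x1; x2; x3]`_i.

Definition qc q (i : nat) : R := q ord0 (inord i).

Definition qone : quat R := mkquat 1 0 0 0.

Definition qmul p q : quat R := mkquat
  (qc p 0 * qc q 0 - qc p 1 * qc q 1 - qc p 2 * qc q 2 - qc p 3 * qc q 3)
  (qc p 0 * qc q 1 + qc p 1 * qc q 0 + qc p 2 * qc q 3 - qc p 3 * qc q 2)
  (qc p 0 * qc q 2 - qc p 1 * qc q 3 + qc p 2 * qc q 0 + qc p 3 * qc q 1)
  (qc p 0 * qc q 3 + qc p 1 * qc q 2 - qc p 2 * qc q 1 + qc p 3 * qc q 0).

Definition qconj q : quat R := mkquat (qc q 0) (- qc q 1) (- qc q 2) (- qc q 3).

Definition qnorm q : R := Num.sqrt (\sum_(i < 4) q ord0 i ^+ 2).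

Definition qinv q : quat R := (qnorm q ^+ 2)^-1 *: qconj q.

Lemma qc_mkquat x0 x1 x2 x3 : (qc (mkquat x0 x1 x2 x3) 0 = x0) *
  (qc (mkquat x0 x1 x2 x3) 1 = x1) * (qc (mkquat x0 x1 x2 x3) 2 = x2) *
  (qc (mkquat x0 x1 x2 x3) 3 = x3).
Proof. by rewrite /qc !mxE !inordK. Qed.

Lemma qcD p q i : qc (p + q) i = qc p i + qc q i.
Proof. by rewrite /qc mxE. Qed.

Lemma qcZ (a : R) q i : qc (a *: q) i = a * qc q i.
Proof. by rewrite /qc mxE. Qed.

Lemma qc0 i : qc 0 i = 0.
Proof. by rewrite /qc mxE. Qed.

Lemma quatP p q : qc p 0 = qc q 0 -> qc p 1 = qc q 1 -> qc p 2 = qc q 2 ->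
  qc p 3 = qc q 3 -> p = q.
Proof.
move=> e0 e1 e2 e3; apply/rowP => i; rewrite -(inord_val i).
by case: i => -[|[|[|[|]]]].
Qed.

Lemma qnormE q :
  qnorm q ^+ 2 = qc q 0 ^+ 2 + qc q 1 ^+ 2 + qc q 2 ^+ 2 + qc q 3 ^+ 2.
Proof.
rewrite sqr_sqrtr; last by apply: sumr_ge0 => i _; rewrite sqr_ge0.
rewrite !big_ord_recr big_ord0 /= add0r /qc.
by congr (_ ^+ 2 + _ ^+ 2 + _ ^+ 2 + _ ^+ 2); congr (q _ _); apply/val_inj;
  rewrite /= inordK.
Qed.

Lemma qmulA : associative qmul.
Proof. by move=> p q r; apply: quatP; rewrite !qc_mkquat; ring. Qed.

Lemma qmul1l : left_id qone qmul.
Proof. by move=> p; apply: quatP; rewrite !qc_mkquat; ring. Qed.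

Lemma qmul1r : right_id qone qmul.
Proof. by move=> p; apply: quatP; rewrite !qc_mkquat; ring. Qed.

Lemma qmulDl : left_distributive qmul +%R.
Proof. by move=> p q r; apply: quatP; rewrite !(qcD, qc_mkquat); ring. Qed.

Lemma qmulDr : right_distributive qmul +%R.
Proof. by move=> p q r; apply: quatP; rewrite !(qcD, qc_mkquat); ring. Qed.

Lemma qone_neq0 : qone != 0.
Proof.
apply/eqP => /(congr1 (qc^~ 0)); rewrite qc_mkquat qc0.
by move/eqP; rewrite oner_eq0.
Qed.

HB.instance Definition _ := GRing.Zmodule_isNzRing.Build (quat R)
  qmulA qmul1l qmul1r qmulDl qmulDr qone_neq0.

Lemma qnorm2_neq0 q : q != 0 -> qnorm q ^+ 2 != 0.
Proof.
apply: contraNneq; rewrite qnormE => /eqP.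
do 3 (rewrite paddr_eq0 ?addr_ge0 ?sqr_ge0// => /andP[]).
by rewrite !sqrf_eq0 => /eqP ? /eqP ? /eqP ? /eqP ?; apply/eqP/quatP; rewrite qc0.
Qed.

Lemma qmulVq : {in [pred q : quat R | q != 0], left_inverse 1 qinv *%R}.
Proof.
move=> q /qnorm2_neq0; rewrite qnormE => qN0.
apply: quatP; rewrite !(qcZ, qc_mkquat) qnormE; by field.
Qed.

Lemma qmulqV : {in [pred q : quat R | q != 0], right_inverse 1 qinv *%R}.
Proof.
move=> q /qnorm2_neq0; rewrite qnormE => qN0.
apply: quatP; rewrite !(qcZ, qc_mkquat) qnormE; by field.
Qed.

Lemma quat_unitP p q : q * p = 1 /\ p * q = 1 -> [pred q : quat R | q != 0] p.
Proof.
move=> [qp1 _] /=; apply/eqP => p0; move/eqP: qp1.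
by rewrite p0 mulr0 eq_sym oner_eq0.
Qed.

Lemma qinv_out : {in [predC [pred q : quat R | q != 0]], qinv =1 id}.
Proof.
move=> q; rewrite inE /= negbK => /eqP ->; rewrite /qinv.
by apply: quatP; rewrite !(qcZ, qc_mkquat, qc0) ?oppr0 mulr0.
Qed.

HB.instance Definition _ := GRing.NzRing_hasMulInverse.Build (quat R)
  qmulVq qmulqV quat_unitP qinv_out.

End Quaternions.

Section SliceMobius.
Context {R : realType}.
Local Notation H := (quat R).
Implicit Types (f g : H -> H) (a : nat -> H) (A : 'M[H]_2).

Definition qball : set H := [set q | qnorm q < 1].

(* A function on the unit ball is a total function vanishing outside of it, so
   that equality in [H -> H] is equality on the ball. *)
Definition powser a : H -> H := fun q =>
  if q \in qball then limn (series (fun n => q ^+ n * a n)) else 0.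

(* The coefficients, necessarily unique, of the expansion of f on the ball;
   the value is irrelevant when f has no such expansion. *)
Definition coefs f : nat -> H := xget (fun=> 0) [set a | forall q, qball q ->
  series (fun n => q ^+ n * a n) @ \oo --> f q].

Definition star f g : H -> H :=
  powser (fun n => \sum_(k < n.+1) coefs f k * coefs g (n - k)%N).

Definition regconj f : H -> H := powser (fun n => qconj (coefs f n)).

Definition symmetrization f : H -> H := star f (regconj f).

Definition star_recip f : H -> H := fun q =>
  (symmetrization f q)^-1 * regconj f q.

Definition lmap (a b : H) : H -> H := fun q => q * a + b.

(* For A = [[a, c], [b, d]], the first column (a, b) is the numerator. *)
Definition mobius A : H -> H :=
  star (star_recip (lmap (A 0 1) (A 1 1))) (lmap (A 0 0) (A 1 0)).

Definition phi (au : H * H) : H -> H :=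
  star (star_recip (lmap (- qconj au.1) 1)) (lmap au.2 (- (au.1 * au.2))).

Definition adjoint A : 'M[H]_2 := (map_mx qconj A)^T.

Definition I11 : 'M[H]_2 := diag_mx (\row_(i < 2) (if i == 0 then 1 else -1)).

Definition Sp11 : set 'M[H]_2 := [set A | adjoint A *m I11 *m A = I11].

Definition Sp1 : set H := [set u | qnorm u = 1].

Definition MobB : set (H -> H) := mobius @` Sp11.

(* [invmx] requires commutative entries. *)
Definition inv2 A : 'M[H]_2 :=
  xget 0 [set B | A *m B = 1%:M /\ B *m A = 1%:M].

Definition coset A : set 'M[H]_2 := [set A *m u%:M | u in Sp1].

Definition Sp11_quot : set (set 'M[H]_2) := coset @` Sp11.

(* The map A Sp(1)I_2 |-> F_(A^-1), computed on a chosen element of the coset;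
   it does not depend on that choice. *)
Definition quot_to_Mob (C : set 'M[H]_2) : H -> H :=
  mobius (inv2 (xget 0 C)).

End SliceMobius.

Section Smooth.
Context {R : realType} {V W : normedModType R}.

(* C^k on U, for U open: by recursion on k, all directional derivatives exist
   and are C^(k-1). *)
Fixpoint Ck (k : nat) (U : set V) (f : V -> W) : Prop :=
  (forall x, U x -> {for x, continuous f}) /\
  if k is k'.+1 then
    forall v, (forall x, U x -> derivable f x v) /\ Ck k' U ('D_v f)
  else True.

Definition smooth_on (U : set V) (f : V -> W) := forall k, Ck k U f.

End Smooth.

(* A chart on a subset of X with values in R^n.  Only the values of [cmap] on
   [cdom] and of [cinv] on the image of [cdom] matter. *)
Record chart (R : realType) (X : Type) (n : nat) := Chart {
  cdom : set X;
  cmap : X -> 'rV[R]_n;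
  cinv : 'rV[R]_n -> X }.

Definition cimage (R : realType) X n (c : chart R X n) (D : set X) :
  set 'rV[R]_n := cmap c @` (cdom c `&` D).

(* A smooth structure on the set S is given by an atlas A, not necessarily
   maximal; S carries the topology for which the charts are homeomorphisms. *)
Section Manifolds.
Context {R : realType}.

Definition mopen X n (S : set X) (A : set (chart R X n)) (D : set X) :=
  D `<=` S /\ forall c, A c -> open (cimage c D).

Definition is_atlas X n (S : set X) (A : set (chart R X n)) :=
  [/\ forall c, A c -> [/\ cdom c `<=` S, open (cimage c setT) &
        {in cdom c, cancel (cmap c) (cinv c)}],
      S `<=` \bigcup_(c in A) cdom c &
      forall c d, A c -> A d -> open (cimage c (cdom d)) /\
        smooth_on (cimage c (cdom d)) (cmap d \o cinv c)].

Definition is_manifold X n (S : set X) (A : set (chart R X n)) :=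
  [/\ is_atlas S A,
      forall x y, S x -> S y -> x <> y -> exists D E : set X,
        [/\ mopen S A D, mopen S A E, D x, E y & D `&` E = set0] &
      exists2 B : set (set X), countable B & B `<=` mopen S A /\
        forall D x, mopen S A D -> D x -> exists E, [/\ B E, E x & E `<=` D]].

Definition smooth_map X n (S : set X) (A : set (chart R X n))
    Y m (T : set Y) (B : set (chart R Y m)) (h : X -> Y) :=
  [/\ h @` S `<=` T,
      forall D, mopen T B D -> mopen S A (S `&` h @^-1` D) &
      forall c d, A c -> B d ->
        smooth_on (cimage c (h @^-1` cdom d)) (cmap d \o h \o cinv c)].

Definition submersion X n (S : set X) (A : set (chart R X n))
    Y m (T : set Y) (B : set (chart R Y m)) (h : X -> Y) :=
  smooth_map S A T B h /\
  forall c d x, A c -> B d -> cdom c x -> cdom d (h x) ->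
    set_surj setT setT ('d (cmap d \o h \o cinv c) (cmap c x)).

Definition diffeomorphism X n (S : set X) (A : set (chart R X n))
    Y m (T : set Y) (B : set (chart R Y m)) (h : X -> Y) :=
  exists g : Y -> X, [/\ smooth_map S A T B h, smooth_map T B S A g,
    {in S, cancel h g} & {in T, cancel g h}].

(* The charts of the embedded submanifold iota(S) of R^N: diffeomorphisms
   between a relatively open subset of S and an open subset of R^n, where a map
   on a subset of R^N is smooth if it extends smoothly around each point. *)
Definition embedded_charts X N (iota : X -> 'rV[R]_N) (S : set X) (n : nat) :
  set (chart R X n) := [set c |
    [/\ exists2 O, open O & cdom c = S `&` iota @^-1` O,
        open (cimage c setT),
        {in cdom c, cancel (cmap c) (cinv c)},
        smooth_on (cimage c setT) (iota \o cinv c) &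
        forall x, cdom c x -> exists O (F : 'rV[R]_N -> 'rV[R]_n),
          [/\ open O, O (iota x), smooth_on O F &
              forall y, cdom c y -> O (iota y) -> F (iota y) = cmap c y]]].
Arguments embedded_charts [X N] iota S n.

Definition prod_chart X n Y m (c : chart R X n) (d : chart R Y m) :
  chart R (X * Y) (n + m) := Chart (cdom c `*` cdom d)
    (fun xy => row_mx (cmap c xy.1) (cmap d xy.2))
    (fun z => (cinv c (lsubmx z), cinv d (rsubmx z))).

Definition prod_charts X n Y m (A : set (chart R X n)) (B : set (chart R Y m)) :
  set (chart R (X * Y) (n + m)) :=
  [set prod_chart cd.1 cd.2 | cd in A `*` B].

Definition Rn_charts n : set (chart R 'rV[R]_n n) :=
  [set Chart setT id id].
Arguments Rn_charts n : clear implicits.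

Definition sphere n : set 'rV[R]_n.+1 := [set x | \sum_i x ord0 i ^+ 2 = 1].
Arguments sphere n : clear implicits.

Definition sphere_charts n : set (chart R 'rV[R]_n.+1 n) :=
  embedded_charts id (sphere n) n.
Arguments sphere_charts n : clear implicits.

(* The 16 real coordinates of a quaternionic 2 x 2 matrix. *)
Definition mx_coords (A : 'M[quat R]_2) : 'rV[R]_((4 + 4) + (4 + 4)) :=
  row_mx (row_mx (A 0 0 : 'rV_4) (A 0 1 : 'rV_4))
         (row_mx (A 1 0 : 'rV_4) (A 1 1 : 'rV_4)).

Definition Sp11_charts : set (chart R 'M[quat R]_2 10) :=
  embedded_charts mx_coords Sp11 10.

Definition qball_charts : set (chart R (quat R) 4) :=
  embedded_charts (id : quat R -> 'rV[R]_4) qball 4.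

Definition Sp1_charts : set (chart R (quat R) 3) :=
  embedded_charts (id : quat R -> 'rV[R]_4) Sp1 3.

End Manifolds.

Arguments embedded_charts {R} [X N] iota S n.
Arguments Rn_charts {R} n.
Arguments sphere {R} n.
Arguments sphere_charts {R} n.

(* Main.v *)
Require Import Defs.
From HB Require Import structures.
From mathcomp Require Import all_boot all_order all_algebra.
From mathcomp Require Import all_classical all_reals all_analysis.
From mathcomp Require Import ring lra.
Import Order.TTheory GRing.Theory Num.Theory.
Import numFieldNormedType.Exports.

Set Implicit Arguments.
Unset Strict Implicit.
Unset Printing Implicit Defensive.

Local Open Scope classical_set_scope.
Local Open Scope ring_scope.

(** The matrix [[u, - conj a], [- a u, 1]] of phi (a, u), normalised to lie
    in Sp(1,1), has an explicit inverse [mob_section (a, u)], and so phi is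
    the composite of three smooth maps: this section of Sp(1,1), the
    projection to the quotient, and the identification of the quotient with
    the Moebius transformations. Conversely the map [mob_param], sending a
    matrix with lower entries b, d and upper left entry p to (b d^-1, conj
    d^-1 conj p), is smooth on Sp(1,1), constant on the cosets, and inverse
    to the section modulo Sp(1). It induces the inverse of phi on the
    quotient.

    Two points need an argument. First, the transformation of A^-1 must be
    phi (mob_param A) ([mobius_inv2]). The matrix A^-1 is conj d times the
    matrix of phi (a, u), and a constant left factor cancels in a star
    quotient of linear polynomials ([star_quotient_mull]); this rests on the
    uniqueness of power series coefficients. Bijectivity of phi is then
    inherited from the given bijection between the quotient and the
    transformations.

    Second, a map on the quotient is smooth as soon as its composite with
    the projection is ([smooth_map_descent]), because a submersion has
    smooth local sections ([local_section]). These come from the inverse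
    function theorem ([inverse_function]), proved by contraction from strict
    differentiability ([strict_diff]).

    The hypothesis on the submersion speaks of charts of Sp(1,1), so such
    charts must be produced. The section splits Sp(1,1) as the product of
    the ball and two copies of Sp(1) ([Sp11_split]); charts are transported
    along this splitting ([embedded_chart_pullback]), from the identity of
    the ball and the translates of the stereographic projection of Sp(1).
    Finally the ball is diffeomorphic to R^4 by radial stretching, and Sp(1)
    is the 3-sphere. *)

(** * Calculus of C^k maps *)

Section CkCalculus.
Context {R : realType} {V W : normedModType R}.
Implicit Types (U : set V) (f g : V -> W) (k : nat).

Lemma open_near U (P : V -> Prop) x : open U -> U x ->
  (forall y, U y -> P y) -> \forall y \near x, P y.
Proof.
by move=> oU Ux UP; near do apply: UP; apply: open_nbhs_nbhs.
Unshelve. all: by end_near. Qed.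

Lemma Ck_continuous k U f x : Ck k U f -> U x -> {for x, continuous f}.
Proof. by case: k => [|k] [+ _]; apply. Qed.

Lemma CkW k U f : Ck k.+1 U f -> Ck k U f.
Proof.
elim: k f => [|k IH] f [cf df]; split => // v.
by have [dfv /IH] := df v.
Qed.

Lemma Ck_le k l U f : (l <= k)%N -> Ck k U f -> Ck l U f.
Proof.
elim: k => [|k IH]; first by rewrite leqn0 => /eqP->.
by rewrite leq_eqVlt => /predU1P[->//|lk /CkW]; exact: IH.
Qed.

Lemma Ck_sub k U U' f : U' `<=` U -> Ck k U f -> Ck k U' f.
Proof.
move=> U'U; elim: k f => [|k IH] f [cf df].
  by split => // x /U'U /cf.
split=> [x /U'U /cf //|v]; have [dfv Dfv] := df v.
by split; [move=> x /U'U /dfv|exact: IH].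
Qed.

Lemma Ck_local k U f :
  (forall x, U x -> exists N, [/\ open N, N x & Ck k N f]) -> Ck k U f.
Proof.
elim: k f => [|k IH] f loc; split => //.
- by move=> x /loc[N [_ Nx [cf _]]]; exact: cf.
- by move=> x /loc[N [_ Nx [cf _]]]; exact: cf.
- move=> v; split=> [x /loc[N [_ Nx [_ /(_ v)[df _]]]]|]; first exact: df.
  by apply: IH => x /loc[N [oN Nx [_ /(_ v)[_ Df]]]]; exists N.
Qed.

Lemma eq_Ck k U f g : open U -> (forall x, U x -> f x = g x) ->
  Ck k U f -> Ck k U g.
Proof.
move=> oU.
have ne f' g' x : (forall x, U x -> f' x = g' x) -> U x ->
    \forall y \near x, f' y = g' y.
  by move=> e Ux; exact: open_near oU Ux e.
have ce f' g' x : (forall x, U x -> f' x = g' x) ->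
    (forall x, U x -> {for x, continuous f'}) -> U x -> {for x, continuous g'}.
  move=> e c Ux; have := cvg_trans (near_eq_cvg (ne _ _ _ e Ux)) (c _ Ux).
  rewrite (e _ Ux) => c'; exact: c'.
elim: k f g => [|k IH] f g fg [cf df]; split => //.
- by move=> x; apply: ce fg cf.
- by move=> x; apply: ce fg cf.
- move=> v; have [dfv Dfv] := df v; split.
    by move=> x Ux; apply: near_eq_derivable (ne _ _ _ fg Ux) _; exact: dfv.
  by apply: IH Dfv => x Ux; apply: near_eq_derive; exact: ne.
Qed.

(** The candidates df need only agree with the directional derivatives on U,
    while [Ck] speaks of the total operator. *)
Lemma CkS k U f (df : V -> V -> W) : open U ->
  (forall x, U x -> {for x, continuous f}) ->
  (forall v x, U x -> is_derive x v f (df v x)) ->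
  (forall v, Ck k U (df v)) -> Ck k.+1 U f.
Proof.
move=> oU cf fdf Cdf; split => // v; split.
  by move=> x /(fdf v)[].
by apply: eq_Ck (Cdf v) => // x /(fdf v)[].
Qed.

Lemma Ck_is_derive k U f v x : Ck k.+1 U f -> U x ->
  is_derive x v f ('D_v f x).
Proof. by move=> [_ /(_ v)[+ _]] Ux => /(_ _ Ux) /derivableP. Qed.

Lemma CkD_derive k U f v : Ck k.+1 U f -> Ck k U ('D_v f).
Proof. by move=> [_ /(_ v)[]]. Qed.

Lemma Ck_cst k U (c : W) : open U -> Ck k U (fun=> c).
Proof.
move=> oU; elim: k c => [|k IH] c.
  by split=> // x _; exact: cvg_cst.
apply: (CkS (df := fun=> fun=> 0)) => // x; first by move=> _; exact: cvg_cst.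
Qed.

Lemma CkD k U f g : open U -> Ck k U f -> Ck k U g ->
  Ck k U (fun x => f x + g x).
Proof.
move=> oU; elim: k f g => [|k IH] f g Cf Cg.
  split=> // x Ux.
  by apply: cvgD; [exact: (Ck_continuous Cf)|exact: (Ck_continuous Cg)].
apply: (CkS (df := fun v x => 'D_v f x + 'D_v g x)) => //.
- move=> x Ux.
  by apply: cvgD; [exact: (Ck_continuous Cf)|exact: (Ck_continuous Cg)].
- move=> v x Ux; have := Ck_is_derive v Cf Ux; have := Ck_is_derive v Cg Ux.
  by move=> *; exact: is_deriveD.
- by move=> v; apply: IH; exact: CkD_derive.
Qed.

Lemma Ck_sum k U n (P : pred 'I_n) (F : 'I_n -> V -> W) : open U ->
  (forall i, P i -> Ck k U (F i)) -> Ck k U (fun x => \sum_(i < n | P i) F i x).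
Proof.
move=> oU CF; rewrite -fct_sumE.
by elim/big_ind: _ => //; [exact: Ck_cst|move=> *; exact: CkD].
Qed.

End CkCalculus.

Section ChainRule.
Context {R : realType} {U V W : normedModType R}.

(** On the line h |-> h *: v + x, a directional derivative is an ordinary
   derivative, to which the chain rule for differentials applies. *)
Lemma is_derive_comp (f : U -> V) (g : V -> W) x v df :
  differentiable g (f x) -> is_derive x v f df ->
  is_derive x v (g \o f) ('d g (f x) df).
Proof.
move=> dg [dfv <-].
have line (W' : normedModType R) (F : U -> W') :
    'D_v F x = 'D_1 (fun h : R => F (h *: v + x)) 0.
  rewrite /derive; set g1 := fun h => h^-1 *: _; set g2 := fun h => h^-1 *: _.
  suff -> : g1 = g2 by [].
  by apply/funext => h; rewrite /g1 /g2/= addr0 scale0r add0r [_%:A]mulr1.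
pose l (h : R) := f (h *: v + x).
have l0 : l 0 = f x by rewrite /l scale0r add0r.
have dl : differentiable l 0 by exact/derivable1_diffP/(derivable1P _ _ _).1.
have dgl : differentiable (g \o l) 0.
  by apply: differentiable_comp; rewrite ?l0.
apply: DeriveDef; first exact/derivable1P/derivable1_diffP.
rewrite !line -/l -[fun h => _]/(g \o l) !deriveE//.
by rewrite diff_comp// ?l0.
Qed.

End ChainRule.

Section CkScalar.
Context {R : realType} {V : normedModType R}.
Implicit Types (U : set V) (f g : V -> R) (k : nat).

Lemma CkM k U f g : open U -> Ck k U f -> Ck k U g ->
  Ck k U (fun x => f x * g x).
Proof.
move=> oU; elim: k f g => [|k IH] f g Cf Cg.
  split=> // x Ux.
  by apply: cvgM; [exact: (Ck_continuous Cf)|exact: (Ck_continuous Cg)].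
apply: (CkS (df := fun v x => f x * 'D_v g x + g x * 'D_v f x)) => //.
- move=> x Ux.
  by apply: cvgM; [exact: (Ck_continuous Cf)|exact: (Ck_continuous Cg)].
- move=> v x Ux; have := Ck_is_derive v Cf Ux; have := Ck_is_derive v Cg Ux.
  by move=> *; exact: is_deriveM.
- by move=> v; apply: CkD => //; apply: IH;
    try exact: CkD_derive; exact: CkW.
Qed.

Lemma CkN k U f : open U -> Ck k U f -> Ck k U (fun x => - f x).
Proof.
move=> oU Cf; have C1 : Ck k U (fun=> - 1 : R) by exact: Ck_cst.
apply: eq_Ck (CkM oU C1 Cf) => // x _.
by rewrite mulN1r.
Qed.

Lemma CkB k U f g : open U -> Ck k U f -> Ck k U g ->
  Ck k U (fun x => f x - g x).
Proof. by move=> oU Cf Cg; apply: CkD => //; exact: CkN. Qed.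

Lemma CkV k U f : open U -> (forall x, U x -> f x != 0) -> Ck k U f ->
  Ck k U (fun x => (f x)^-1).
Proof.
move=> oU f0; elim: k f f0 => [|k IH] f f0 Cf.
  by split=> // x Ux; apply: cvgV; [exact: f0|exact: (Ck_continuous Cf)].
apply: (CkS (df := fun v x => - ((f x)^-1 * (f x)^-1) * 'D_v f x)) => //.
- by move=> x Ux; apply: cvgV; [exact: f0|exact: (Ck_continuous Cf)].
- move=> v x Ux; have [dfv _] := Ck_is_derive v Cf Ux.
  apply: DeriveDef; first exact: derivableV (f0 _ Ux) dfv.
  by rewrite deriveV ?f0// expr2 invfM.
- move=> v; have CV := IH _ f0 (CkW Cf); apply: CkM => //.
    by apply: CkN => //; exact: CkM.
  exact: CkD_derive.
Qed.

Lemma is_derive_sqrt_comp f x v df : 0 < f x -> is_derive x v f df ->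
  is_derive x v (fun y => Num.sqrt (f y)) ((2 * Num.sqrt (f x))^-1 * df).
Proof.
move=> fx0 fdf; have [ds Ds] := is_derive1_sqrt fx0.
have dS : differentiable (@Num.sqrt R) (f x) by exact/derivable1_diffP.
apply: is_derive_eq (is_derive_comp dS fdf) _.
rewrite -[df in LHS]mulr1 linearZ/= -deriveE// Ds.
by rewrite [LHS]mulrC.
Qed.

Lemma Ck_sqrt k U f : open U -> (forall x, U x -> 0 < f x) -> Ck k U f ->
  Ck k U (fun x => Num.sqrt (f x)).
Proof.
move=> oU f0.
have cS g x : {for x, continuous g} ->
  {for x, continuous (Num.sqrt \o (g : V -> R))}.
  by move=> cg; apply: continuous_comp => //; exact: sqrt_continuous.
elim: k f f0 => [|k IH] f f0 Cf.
  by split=> // x Ux; apply: cS; exact: Ck_continuous Cf Ux.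
apply: (CkS (df := fun v x => (2 * Num.sqrt (f x))^-1 * 'D_v f x)) => //.
- by move=> x Ux; apply: cS; exact: Ck_continuous Cf Ux.
- move=> v x Ux; apply: is_derive_sqrt_comp; first exact: f0.
  exact: Ck_is_derive Cf Ux.
- move=> v; apply: CkM => //; last exact: CkD_derive.
  apply: CkV => //.
    by move=> x Ux; rewrite mulf_neq0// ?pnatr_eq0// sqrtr_eq0 -ltNge f0.
  by apply: CkM => //; [exact: Ck_cst|exact: IH f0 (CkW Cf)].
Qed.

Lemma Ck_prod k U n (P : pred 'I_n) (F : 'I_n -> V -> R) : open U ->
  (forall i, P i -> Ck k U (F i)) ->
  Ck k U (fun x => \prod_(i < n | P i) F i x).
Proof.
move=> oU CF; rewrite -fct_prodE.
by elim/big_ind: _ => //; [exact: Ck_cst|move=> *; exact: CkM].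
Qed.

End CkScalar.

Section MatrixValued.
Context {R : realType}.

(* The cast selects the normed space structure of R itself. *)
Local Notation Ckr k U f := (Ck k U (f : _ -> R)).

Lemma mx_norm_leP m n (x : 'M[R]_(m, n)) (e : R) : 0 <= e ->
  reflect (forall i j, `|x i j| <= e) (`|x| <= e).
Proof.
move=> e0; rewrite [`|x|]/Num.norm/= mx_normrE.
apply: (iffP idP) => [xe i j|xe].
  by apply: le_trans xe; apply: (le_bigmax _ (fun ij => `|x ij.1 ij.2|) (i, j)).
by apply: bigmax_le => // -[i j] _ /=.
Qed.

Lemma cvg_coordP T (F : set_system T) (FF : Filter F) m n
    (f : T -> 'M[R]_(m, n)) (l : 'M[R]_(m, n)) :
  f @ F --> l <-> forall i j, (fun x => f x i j) @ F --> l i j.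
Proof.
split=> [fl i j|fl].
  apply: (@cvg_comp _ _ _ f (fun M : 'M[R]_(m, n) => M i j)); first exact: fl.
  exact: coord_continuous.
apply/cvgrPdist_le => e e0; near=> x.
apply/mx_norm_leP; first exact: ltW.
move=> i j; rewrite !mxE; move: i j.
near: x; apply: filter_forall => i; apply: filter_forall => j.
by move/cvgrPdist_le : (fl i j); apply.
Unshelve. all: by end_near. Qed.

Context {V : normedModType R}.

Lemma Ck_mxP k (U : set V) m n (f : V -> 'M[R]_(m, n)) : open U ->
  Ck k U f <-> forall i j, Ckr k U (fun x => f x i j).
Proof.
move=> oU; split=> [+ i j|].
  elim: k f => [|k IH] f Cf.
    split=> // x Ux; have /cvg_coordP := Ck_continuous Cf Ux; exact.
  apply: (CkS (df := fun v x => 'D_v f x i j)) => //.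
  - by move=> x Ux; have /cvg_coordP := Ck_continuous Cf Ux; exact.
  - move=> v x Ux; have [dfv _] := Ck_is_derive v Cf Ux.
    apply: DeriveDef; first exact: (derivable_mxP _ _ _).1 dfv _ _.
    by rewrite derive_mx// mxE.
  - by move=> v; apply: IH; exact: CkD_derive.
elim: k f => [|k IH] f Cf.
  split=> // x Ux; apply/cvg_coordP => i j; exact: (Ck_continuous (Cf i j)).
apply: (CkS (df := fun v x => \matrix_(i, j) 'D_v (fun y => f y i j) x)) => //.
- by move=> x Ux; apply/cvg_coordP => i j; exact: (Ck_continuous (Cf i j)).
- move=> v x Ux.
  have dfv : derivable f x v.
    by apply/derivable_mxP => i j; have [] := Ck_is_derive v (Cf i j) Ux.
  by apply: DeriveDef; last exact: derive_mx.
- move=> v; apply: IH => i j.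
  by apply: eq_Ck (CkD_derive v (Cf i j)) => // x _; rewrite mxE.
Qed.

Lemma Ck_coord k m n (U : set 'M[R]_(m, n)) i j : open U ->
  Ckr k U (fun x => x i j).
Proof.
move=> oU; case: k => [|k]; first by split=> // x _; exact: coord_continuous.
pose df (v x : 'M[R]_(m, n)) : R := v i j.
apply: (CkS (df := df)) => //.
- by move=> x _; exact: coord_continuous.
- move=> v x _; have did : derivable (@id 'M[R]_(m, n)) x v by [].
  apply: DeriveDef; first exact: (derivable_mxP _ _ _).1 did _ _.
  have := derive_mx did; rewrite derive_id => /matrixP/(_ i j).
  by rewrite mxE => <-.
- by move=> v; exact: Ck_cst.
Qed.

Lemma Ck_mulmx k (U : set V) m n p (f : V -> 'M[R]_(m, n))
    (g : V -> 'M[R]_(n, p)) : open U ->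
  Ck k U f -> Ck k U g -> Ck k U (fun x => f x *m g x).
Proof.
move=> oU /(Ck_mxP _ _ oU)-/= Cf /(Ck_mxP _ _ oU)-/= Cg; apply/Ck_mxP => // i j.
have : Ckr k U (fun x => \sum_l f x i l * g x l j).
  by apply: Ck_sum => // l _; exact: CkM.
by apply: eq_Ck => // x _; rewrite mxE.
Qed.

Lemma Ck_det k (U : set V) n (f : V -> 'M[R]_n) : open U ->
  Ck k U f -> Ckr k U (fun x => \det (f x)).
Proof.
move=> oU /(Ck_mxP _ _ oU)-/= Cf; rewrite /determinant -fct_sumE.
elim/big_ind: _ => [||s _]; [exact: Ck_cst|by move=> *; exact: CkD|].
apply: CkM => //; first exact: Ck_cst.
by apply: Ck_prod => // i _; exact: Cf.
Qed.

(** Cramer's rule expresses the inverse by sums, products and one division. *)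
Lemma Ck_invmx k (U : set V) n (f : V -> 'M[R]_n) : open U ->
  (forall x, U x -> f x \in unitmx) ->
  Ck k U f -> Ck k U (fun x => invmx (f x)).
Proof.
move=> oU fU Cf; apply/Ck_mxP => // i j.
have : Ckr k U (fun x => (\det (f x))^-1 * cofactor (f x) j i).
  apply: CkM => //.
    apply: CkV => //; last exact: Ck_det.
    by move=> x /fU; rewrite unitmxE unitfE.
  rewrite /cofactor; apply: CkM => //; first exact: Ck_cst.
  apply: Ck_det => //; apply/Ck_mxP => // a b.
  have := (Ck_mxP k f oU).1 Cf (lift j a) (lift i b).
  by apply: eq_Ck => // x _; rewrite !mxE.
by apply: eq_Ck => // x Ux; rewrite /invmx fU// !mxE.
Qed.

End MatrixValued.

Section Identity.
Context {R : realType}.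

Lemma Ck_id k m n (U : set 'M[R]_(m, n)) : open U -> Ck k U id.
Proof.
by move=> oU; apply: (Ck_mxP k (@id 'M[R]_(m, n)) oU).2 => i j; exact: Ck_coord.
Qed.

End Identity.

(** * Strict differentiability of C^1 maps *)

Section StrictDifferentiability.
Context {R : realType}.

Lemma line_is_derive (V W : normedModType R) (f : V -> W) x v (s : R) df :
  is_derive (x + s *: v) v f df -> is_derive s 1 (fun t : R => f (x + t *: v))
    df.
Proof.
have E : (fun h : R => h^-1 *:
    ((f \o shift (x + s *: v)) (h *: v) - f (x + s *: v))) =
  (fun h : R => h^-1 *: (((fun t : R => f (x + t *: v)) \o shift s) (h *: 1)
       - f (x + s *: v))).
  apply/funext => h /=; congr (_ *: (f _ - _)).
  by rewrite [h%:A]mulr1 scalerDl addrCA.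
by case=> dfv Df; apply: DeriveDef; [rewrite /derivable -E|rewrite /derive -E].
Qed.

(** Mean value theorem on the segment, with both end points near y: the
    derivative at an intermediate point is within e of the one at y. *)
Lemma strict_derive (V : normedModType R) (f : V -> R) (U : set V) (y w : V) :
  open U -> U y -> Ck 1 U f -> forall e : R, 0 < e -> exists2 d : R, 0 < d &
  forall (x : V) (s : R), `|x - y| < d -> `|x + s *: w - y| < d ->
  `|f (x + s *: w) - f x - s * 'D_w f y| <= e * `|s|.
Proof.
move=> oU Uy Cf e e0.
have : \forall z \near y, U z /\ `|'D_w f y - 'D_w f z| < e.
  near=> z; split; first by near: z; exact: open_nbhs_nbhs.
  near: z; have /cvgrPdist_lt := Ck_continuous (CkD_derive w Cf) Uy; exact.
move=> /nbhs_ballP[d /= d0 dU]; exists d => //.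
suff pos (x : V) (s : R) : 0 <= s -> `|x - y| < d -> `|x + s *: w - y| < d ->
    `|f (x + s *: w) - f x - s * 'D_w f y| <= e * `|s|.
  move=> x s xd xsd; have [s0|/ltW s0] := leP 0 s; first exact: pos.
  have := pos (x + s *: w) (- s); rewrite scaleNr addrK oppr_ge0 normrN.
  by move=> /(_ s0 xsd xd); apply: le_trans; rewrite le_eqVlt -normrN;
    apply/orP; left; apply/eqP; congr `|_|; ring.
move=> s0 xd xsd.
have seg (t : R) : 0 <= t <= s ->
    U (x + t *: w) /\ `|'D_w f y - 'D_w f (x + t *: w)| < e.
  move=> /andP[t0 ts]; apply: dU; rewrite -ball_normE /ball_/= distrC.
  have [s00|sn0] := eqVneq s 0.
    have -> : t = 0 by lra.
    by rewrite scale0r addr0.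
  have sp : 0 < s by rewrite lt_def sn0.
  have [l [l0 l1 ->]] : exists l : R, [/\ 0 <= l, l <= 1 & t = l * s].
    by exists (t / s); rewrite divr_ge0 ?ler_pdivrMr ?mul1r ?divfK// ltW.
  have -> : x + (l * s) *: w - y = (1 - l) *: (x - y) + l *: (x + s *: w - y).
    rewrite ![x + _ - y]addrAC; move: (x - y) => a.
    by rewrite scalerBl scale1r scalerDr addrA subrK scalerA.
  apply: (le_lt_trans (ler_normD _ _)); rewrite (normrZ l) (normrZ (1 - l)).
  rewrite (ger0_norm l0) ger0_norm ?subr_ge0//.
  have [le0|ln0] := eqVneq l 0; first by rewrite le0 subr0 mul1r mul0r addr0.
  have lp : 0 < l by rewrite lt_def ln0.
  have : (1 - l) * `|x - y| <= (1 - l) * d by rewrite ler_wpM2l ?subr_ge0// ltW.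
  have : l * `|x + s *: w - y| < l * d by rewrite ltr_pM2l.
  lra.
have der (t : R) : 0 <= t <= s ->
    is_derive t 1 (fun t : R => f (x + t *: w)) ('D_w f (x + t *: w)).
  by move=> /seg[Ut _]; apply: line_is_derive; exact: Ck_is_derive Cf Ut.
have [||c] := @MVT_segment R (fun t => f (x + t *: w))
  (fun t => 'D_w f (x + t *: w)) _ _ s0.
- by move=> t; rewrite in_itv/= => /andP[/ltW a /ltW b]; apply: der; rewrite a.
- apply: derivable_within_continuous => t.
  by rewrite in_itv/= => /der[].
rewrite in_itv/= => /seg[_ ce]; rewrite scale0r addr0 subr0 => ->.
by rewrite mulrC -mulrBr normrM mulrC distrC ler_wpM2r// ltW.
Unshelve. all: by end_near. Qed.

Local Notation "''e_' i" := (delta_mx 0 i : 'rV__).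

Lemma strict_diff_scalar m (f : 'rV[R]_m -> R) (U : set 'rV[R]_m) y :
  open U -> U y -> Ck 1 U f -> forall e : R, 0 < e -> exists2 d : R, 0 < d &
  forall x k, `|x - y| < d -> `|x + k - y| < d ->
  `|f (x + k) - f x - \sum_i k 0 i * 'D_('e_i) f y| <= e * `|k|.
Proof.
move=> oU Uy Cf e e0; pose e' := e / m.+1%:R.
have e'0 : 0 < e' by rewrite divr_gt0.
have : \forall d \near 0^'+, forall i : 'I_m, forall (x : 'rV[R]_m) (s : R),
    `|x - y| < d -> `|x + s *: 'e_i - y| < d ->
  `|f (x + s *: 'e_i) - f x - s * 'D_('e_i) f y| <= e' * `|s|.
  apply: filter_forall => i.
  have [d d0 dP] := strict_derive 'e_i oU Uy Cf e'0.
  near=> d' => x s xd xsd; apply: dP.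
    by apply: lt_le_trans xd _; near: d'; exact: nbhs_right_le.
  by apply: lt_le_trans xsd _; near: d'; exact: nbhs_right_le.
move=> H; have [d [d0 dP]] : exists d, 0 < d /\
  (forall i : 'I_m, forall (x : 'rV[R]_m) (s : R),
    `|x - y| < d -> `|x + s *: 'e_i - y| < d ->
  `|f (x + s *: 'e_i) - f x - s * 'D_('e_i) f y| <= e' * `|s|).
  near (0 : R)^'+ => d; exists d; split => //.
  exact: (near H d).
exists (d / 3) => [|x k xd xkd]; first by rewrite divr_gt0.
(* replace the coordinates of x by those of x + k one at a time *)
pose P j : 'rV[R]_m := \row_i (if (i < j)%N then k 0 i else 0).
have Pk j : `|P j| <= `|k|.
  apply/mx_norm_leP => // a i; rewrite !mxE; case: ifP => _;
    last by rewrite normr0.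
  by have /mx_norm_leP : `|k| <= `|k| by []; apply.
have kd : `|k| < 2 * (d / 3).
  have -> : k = (x + k - y) - (x - y) by rewrite opprB addrA subrK addrC addKr.
  by apply: le_lt_trans (ler_normB _ _) _; lra.
have Pd j : `|x + P j - y| < d.
  rewrite addrAC; apply: le_lt_trans (ler_normD _ _) _.
  by have := Pk j; lra.
have main j : (j <= m)%N ->
    `|f (x + P j) - f x - \sum_(i < m | (i < j)%N) k 0 i * 'D_('e_i) f y|
    <= j%:R * e' * `|k|.
  elim: j => [|j IH] jm.
    rewrite big_pred0//; have -> : P 0 = 0 by apply/rowP => i; rewrite !mxE.
    by rewrite addr0 subrr subr0 normr0 !mul0r.
  pose i0 := Ordinal jm.
  have PS : P j.+1 = P j + k 0 i0 *: 'e_i0.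
    apply/rowP => i; rewrite !mxE ltnS leq_eqVlt.
    have [->|ii0] := eqVneq i i0; first by rewrite /= eqxx ltnn mulr1 add0r.
    rewrite mulr0 addr0; suff -> : (i == j :> nat) = false by [].
    by apply: contra_neqF ii0 => /eqP ij; exact/val_inj.
  rewrite (bigD1 i0) ?leqnn//=.
  have -> : \sum_(i < m | (i < j.+1)%N && (i != i0)) k 0 i * 'D_('e_i) f y =
      \sum_(i < m | (i < j)%N) k 0 i * 'D_('e_i) f y.
    by apply: eq_bigl => i; rewrite ltnS [RHS]ltn_neqAle andbC.
  have := dP i0 (x + P j) (k 0 i0) (Pd j).
  have <- : x + P j.+1 = x + P j + k 0 i0 *: 'e_i0 by rewrite PS addrA.
  move=> /(_ (Pd _)).
  have := IH (ltnW jm).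
  have : e' * `|k 0 i0| <= e' * `|k|.
    by rewrite ler_pM2l//; have /mx_norm_leP : `|k| <= `|k| by []; apply.
  set A := \sum_(i < m | _) _; set B := k 0 i0 * _ => h1 h2 h3.
  have -> : f (x + P j.+1) - f x - (B + A) =
      (f (x + P j) - f x - A) + (f (x + P j.+1) - f (x + P j) - B) by ring.
  apply: le_trans (ler_normD _ _) _.
  rewrite -natr1 2!mulrDl mul1r; lra.
have := main m (leqnn m).
have -> : P m = k by apply/rowP => i; rewrite !mxE ltn_ord.
rewrite (eq_bigl xpredT) => [h|i]; last by rewrite ltn_ord.
apply: le_trans h _; rewrite ler_wpM2r// /e' mulrCA ger_pMr//.
by rewrite ler_pdivrMr ?mul1r ?ler_nat// ltr0n.
Unshelve. all: by end_near. Qed.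

(** Rows are the partial derivatives, as matrices act on row vectors from the
    right. *)
Definition Jac m p (g : 'rV[R]_m -> 'rV[R]_p) (y : 'rV[R]_m) : 'M[R]_(m, p) :=
  \matrix_(i, j) 'D_('e_i) g y 0 j.

(** Near y the map is its differential up to an e-Lipschitz error. This single
    estimate yields differentiability, the contraction property behind local
    inverses, and the derivative of the inverse. *)
Lemma strict_diff m p (g : 'rV[R]_m -> 'rV[R]_p) (U : set 'rV[R]_m) y :
  open U -> U y -> Ck 1 U g -> forall e : R, 0 < e -> exists2 d : R, 0 < d &
  forall x k, `|x - y| < d -> `|x + k - y| < d ->
  `|g (x + k) - g x - k *m Jac g y| <= e * `|k|.
Proof.
move=> oU Uy Cg e e0.
have : \forall d \near 0^'+, forall j : 'I_p, forall x k : 'rV[R]_m,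
    `|x - y| < d -> `|x + k - y| < d ->
  `|(g (x + k) - g x - k *m Jac g y) 0 j| <= e * `|k|.
  apply: filter_forall => j.
  have [d d0 dP] := strict_diff_scalar oU Uy ((Ck_mxP 1 g oU).1 Cg 0 j) e0.
  near=> d' => x k xd xkd.
  have -> : (g (x + k) - g x - k *m Jac g y) 0 j =
      g (x + k) 0 j - g x 0 j - \sum_i k 0 i * 'D_('e_i) (fun x => g x 0 j) y.
    rewrite !mxE; congr (_ - _); apply: eq_bigr => i _; rewrite mxE.
    by have [Dg _] := Ck_is_derive 'e_i Cg Uy; rewrite derive_mx// mxE.
  apply: dP.
    by apply: lt_le_trans xd _; near: d'; exact: nbhs_right_le.
  by apply: lt_le_trans xkd _; near: d'; exact: nbhs_right_le.
move=> H; near (0 : R)^'+ => d; exists d => // x k xd xkd.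
apply/mx_norm_leP; first by rewrite mulr_ge0// ltW.
move=> i j; rewrite (ord1 i).
have Hd : forall (j : 'I_p) (x k : 'rV[R]_m), `|x - y| < d ->
  `|x + k - y| < d ->
    `|(g (x + k) - g x - k *m Jac g y) 0 j| <= e * `|k| by exact: (near H d).
exact: Hd.
Unshelve. all: by end_near. Qed.

Lemma mulmxr_continuous m p (J : 'M[R]_(m, p)) :
  continuous (mulmxr J : 'rV[R]_m -> 'rV[R]_p).
Proof.
move=> x; have oT : open [set: 'rV[R]_m] by exact: openT.
have : Ck 0 [set: 'rV[R]_m] (fun x => x *m J).
  by apply: Ck_mulmx => //; [exact: Ck_id|exact: Ck_cst].
by move/Ck_continuous; apply.
Qed.

Lemma C1_diff m p (g : 'rV[R]_m -> 'rV[R]_p) (U : set 'rV[R]_m) y :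
  open U -> U y -> Ck 1 U g ->
  differentiable g y /\ 'd g y = mulmxr (Jac g y) :> (_ -> _).
Proof.
move=> oU Uy Cg; have cJ := @mulmxr_continuous _ _ (Jac g y).
have E : g \o shift y = cst (g y) + mulmxr (Jac g y) +o_ (0 : 'rV[R]_m) id.
  apply/eqaddoP => e e0; have [d d0 dP] := strict_diff oU Uy Cg e0.
  near=> k; have kd : `|k| < d by near: k; exact: (@nbhs0_lt R 'rV[R]_m d d0).
  rewrite /= !fctE [k + y]addrC opprD addrA.
  by apply: dP; rewrite ?[y + k]addrC ?addrK// subrr normr0.
have D := diff_unique cJ E.
by split=> //; apply/diff_locallyP; rewrite D.
Unshelve. all: by end_near. Qed.

Lemma C1_diff_scalar m (g : 'rV[R]_m -> R) (U : set 'rV[R]_m) y :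
  open U -> U y -> Ck 1 U g ->
  differentiable g y /\ forall k, 'd g y k = \sum_i k 0 i * 'D_('e_i) g y.
Proof.
move=> oU Uy Cg.
have L : linear (fun k : 'rV[R]_m => \sum_i k 0 i * 'D_('e_i) g y).
  move=> a u v; rewrite scaler_sumr -big_split; apply: eq_bigr => i _ /=.
  by rewrite !mxE mulrDl -scalerAl.
pose Lm := GRing.isLinear.Build _ _ _ _ _ L.
pose l : {linear 'rV[R]_m -> R} := HB.pack (fun k : 'rV[R]_m =>
  \sum_i k 0 i * 'D_('e_i) g y) Lm.
have cl : continuous l.
  move=> x; have oT : open [set: 'rV[R]_m] by exact: openT.
  have : Ck 0 [set: 'rV[R]_m] ((fun k => \sum_i k 0 i * 'D_('e_i) g y) : _ ->
    R).
    by apply: Ck_sum => // i _; apply: CkM => //;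
      [exact: Ck_coord|exact: Ck_cst].
  by move/Ck_continuous; apply.
have E : g \o shift y = cst (g y) + l +o_ (0 : 'rV[R]_m) id.
  apply/eqaddoP => e e0; have [d d0 dP] := strict_diff_scalar oU Uy Cg e0.
  near=> k; have kd : `|k| < d by near: k; exact: (@nbhs0_lt R 'rV[R]_m d d0).
  rewrite /= !fctE [k + y]addrC opprD addrA.
  by apply: dP; rewrite ?[y + k]addrC ?addrK// subrr normr0.
have D := diff_unique cl E.
split; first by apply/diff_locallyP; rewrite D.
by move=> k; rewrite D.
Unshelve. all: by end_near. Qed.

Lemma Ck_comp_scalar (V : normedModType R) k m (U : set V) (U' : set 'rV[R]_m)
    (f : V -> 'rV[R]_m) (g : 'rV[R]_m -> R) :
  open U -> open U' -> (forall x, U x -> U' (f x)) ->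
  Ck k U f -> Ck k U' g -> Ck k U (fun x => g (f x)).
Proof.
move=> oU oU' fU; have cc g' : Ck 0 U f -> Ck 0 U' g' ->
  Ck 0 U (fun x => g' (f x) : R).
  move=> [cf _] [cg _]; split=> // x Ux.
  by apply: continuous_comp; [exact: cf|exact: cg (fU _ Ux)].
elim: k g => [|k IH] g Cf Cg; first exact: cc.
apply: (CkS (df := fun v x => \sum_i ('D_v f x) 0 i * 'D_('e_i) g (f x))) => //.
- by case: (cc g (Ck_le (leq0n _) Cf) (Ck_le (leq0n _) Cg)).
- move=> v x Ux.
  have [dg Dg] := C1_diff_scalar oU' (fU _ Ux) (@Ck_le _ _ _ k.+1 1 _ _ isT Cg).
  by apply: is_derive_eq (is_derive_comp dg (Ck_is_derive v Cf Ux)) _;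
    exact: Dg.
- move=> v; apply: Ck_sum => // i _; apply: CkM => //.
    exact: (Ck_mxP _ _ oU).1 (CkD_derive v Cf) 0 i.
  exact: (IH _ (CkW Cf) (CkD_derive 'e_i Cg)).
Qed.

Lemma Ck_comp (V : normedModType R) k m p q (U : set V) (U' : set 'rV[R]_m)
    (f : V -> 'rV[R]_m) (g : 'rV[R]_m -> 'M[R]_(p, q)) :
  open U -> open U' -> (forall x, U x -> U' (f x)) ->
  Ck k U f -> Ck k U' g -> Ck k U (fun x => g (f x)).
Proof.
move=> oU oU' fU Cf Cg; apply/Ck_mxP => // i j.
exact: (Ck_comp_scalar oU oU' fU Cf) ((Ck_mxP _ _ oU').1 Cg i j).
Qed.

End StrictDifferentiability.

(** * Inverse functions and local sections *)

Section InverseFunction.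
Context {R : realType}.
Local Notation "''e_' i" := (delta_mx 0 i : 'rV__).

Lemma smooth_Jac m p (g : 'rV[R]_m -> 'rV[R]_p) (U : set 'rV[R]_m) :
  open U -> smooth_on U g -> smooth_on U (Jac g).
Proof.
move=> oU sg k; apply/Ck_mxP => // i j.
have := (Ck_mxP _ _ oU).1 (CkD_derive 'e_i (sg k.+1)) 0 j.
by apply: eq_Ck => // x _; rewrite mxE.
Qed.

(** A preimage of z is a fixed point of y |-> z + y - f y, which is a
    contraction near y0 because the Jacobian there is the identity. The inverse
    is 2-Lipschitz, which lets its derivative be read off from the expansion of
    f; as that derivative is invmx of the Jacobian of f composed with the
    inverse, regularity increases by induction. *)
Lemma inverse_function n (f : 'rV[R]_n -> 'rV[R]_n) (U : set 'rV[R]_n) y0 :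
  open U -> U y0 -> smooth_on U f -> Jac f y0 = 1%:M ->
  exists (V : set 'rV[R]_n) (s : 'rV[R]_n -> 'rV[R]_n),
  [/\ open V, V (f y0), smooth_on V s, s (f y0) = y0 &
      forall z, V z -> U (s z) /\ f (s z) = z].
Proof.
move=> oU Uy0 sf J1.
have sJ := smooth_Jac oU sf.
have [d d0 [dU dJ dL]] : exists2 d : R, 0 < d &
  [/\ forall y, `|y - y0| < d -> U y,
      forall y, `|y - y0| < d -> Jac f y \in unitmx &
      forall x k, `|x - y0| < d -> `|x + k - y0| < d ->
        `|f (x + k) - f x - k| <= 2^-1 * `|k|].
  have h0 : 0 < 2^-1 :> R by rewrite invr_gt0.
  have [d1 d10 dL] := strict_diff oU Uy0 (sf 1) h0.
  have : \forall y \near y0, U y /\ Jac f y \in unitmx.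
    near=> y; split; first by near: y; exact: open_nbhs_nbhs.
    rewrite unitmxE unitfE; near: y.
    have cd := Ck_continuous (Ck_det oU (sJ 0)) Uy0.
    by apply: (cvgr_neq0 _ cd); rewrite J1 det1 oner_neq0.
  move=> /nbhs_ballP[d2 /= d20 dU]; exists (Num.min d1 d2).
    by rewrite lt_min d10.
  have bU y : `|y - y0| < Num.min d1 d2 -> U y /\ Jac f y \in unitmx.
    by rewrite lt_min => /andP[_ yd]; apply: dU; rewrite -ball_normE /ball_/=
      distrC.
  split=> [y /bU[]//|y /bU[]//|x k].
  rewrite !lt_min => /andP[xd _] /andP[xkd _].
  by have := dL _ _ xd xkd; rewrite J1 mulmx1.
have lip x y : `|x - y0| < d -> `|y - y0| < d -> `|x - y| <= 2 * `|f x - f y|.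
  move=> xd yd; have := dL y (x - y) yd; rewrite subrKC => /(_ xd).
  have := ler_normB (f x - f y) (f x - f y - (x - y)).
  rewrite opprB addrC subrK; lra.
pose r := d / 2; have r0 : 0 < r by rewrite divr_gt0.
have rd : r < d by rewrite /r; lra.
(* z within r / 2 of f y0, and contraction by 1 / 2, keep the ball of radius r
   stable *)
have ex z : `|z - f y0| < r / 2 -> exists y, `|y - y0| <= r /\ f y = z.
  move=> zr; pose B : set 'rV[R]_n := closed_ball_ Num.norm y0 r.
  pose T y := z + y - f y.
  have BT : set_fun B B T.
    move=> y; rewrite /B /closed_ball_ /= distrC => yr.
    have := dL y0 (y - y0); rewrite subrr normr0 => /(_ d0).
    rewrite subrKC => /(_ (le_lt_trans yr rd)) yL.
    have -> : y0 - T y = (f y - f y0 - (y - y0)) - (z - f y0).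
      rewrite /T; apply/rowP => i; rewrite !mxE; ring.
    apply: le_trans (ler_normB _ _) _.
    have : 2^-1 * `|y - y0| <= 2^-1 * r by rewrite ler_pM2l.
    lra.
  have cB : closed B by exact: closed_closed_ball_.
  have [p Bp pE] : exists2 p, B p & p = mkfun BT p.
    pose E : completeNormedModType R := HB.pack 'rV[R]_n.
    apply: (@banach_fixed_point R E B (mkfun_fun BT)) => //; last by exists y0;
      rewrite /B /closed_ball_/= subrr normr0 ltW.
    exists (2^-1)%:nng; split; first by rewrite /= invf_lt1// ltr1n.
    move=> [x y] [Bx By] /=; rewrite /T.
    have Bd w : B w -> `|w - y0| < d.
      by rewrite /B /closed_ball_/= distrC => /le_lt_trans; apply.
    have := dL y (x - y) (Bd _ By); rewrite subrKC => /(_ (Bd _ Bx)).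
    rewrite -normrN; congr (`|_| <= _); apply/rowP => i; rewrite !mxE; ring.
  exists p; split; first by move: Bp; rewrite /B /closed_ball_/= distrC.
  by move/rowP: pE => pE; apply/rowP => i; have := pE i; rewrite !mxE; lra.
pose s z := xget y0 [set y | `|y - y0| <= r /\ f y = z].
have sP z : `|z - f y0| < r / 2 -> `|s z - y0| <= r /\ f (s z) = z.
  by move=> /ex[y yP]; rewrite /s; case: xgetP => [y' _ //|/(_ y)]; case.
have sd z : `|z - f y0| < r / 2 -> `|s z - y0| < d.
  by move=> /sP[sr _]; exact: le_lt_trans sr rd.
pose V : set 'rV[R]_n := ball (f y0) (r / 2).
have VE z : V z -> `|z - f y0| < r / 2.
  by rewrite /V -ball_normE /ball_/= distrC.
have oV : open V by exact: ball_open.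
have Vf : V (f y0) by apply: ballxx; rewrite divr_gt0.
have slip z z' : V z -> V z' -> `|s z - s z'| <= 2 * `|z - z'|.
  move=> /VE zV /VE z'V; apply: le_trans (lip _ _ (sd _ zV) (sd _ z'V)) _.
  by rewrite (sP _ zV).2 (sP _ z'V).2.
have sU z : V z -> U (s z) by move=> /VE/sd/dU.
have fs z : V z -> f (s z) = z by move=> /VE/sP[].
have cs z : V z -> {for z, continuous s}.
  move=> Vz; apply: (cvgrPdist_lt (FF := nbhs_filter z) _ _).2 => e e0; near=>
    z'.
  have Vz' : V z' by near: z'; exact: open_nbhs_nbhs.
  apply: le_lt_trans (slip _ _ Vz Vz') _.
  have : `|z - z'| < e / 2.
    near: z'; apply/nbhs_ballP; exists (e / 2) => [|w]; first by rewrite /=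
      divr_gt0.
    by rewrite -ball_normE.
  lra.
have ds v z : V z -> is_derive z v s (v *m invmx (Jac f (s z))).
  move=> Vz.
  suff H : h^-1 *: (s (h *: v + z) - s z) @[h --> 0^'] -->
    v *m invmx (Jac f (s z)).
    by apply: DeriveDef; [apply/cvg_ex; eexists; exact: H|exact: cvg_lim H].
  pose J := Jac f (s z); pose k h := s (h *: v + z) - s z.
  (* h *: v - k h *m J is o(k h), and k h is O(h) *)
  have Jv : (h^-1 *: k h) *m J @[h --> 0^'] --> v.
    apply/cvgrPdist_le => e e0; pose e1 := e / (2 * (`|v| + 1)).
    have v1 : 0 < `|v| + 1 by rewrite ltr_wpDl.
    have e10 : 0 < e1 by rewrite divr_gt0// mulr_gt0.
    have [d1 d10 dP] := strict_diff oU (sU _ Vz) (sf 1) e10.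
    have [d2 d20 dV] : exists2 d2 : R, 0 < d2 & forall w, `|w| < d2 ->
      V (w + z).
      have /nbhs_ballP[d2 /= d20 dV] : nbhs z V by exact: open_nbhs_nbhs.
      exists d2 => // w wd; apply: dV.
      by rewrite -ball_normE /ball_/= opprD addrCA subrr addr0 normrN.
    have hv0 d3 : 0 < d3 -> \forall h \near (0 : R)^', `|h *: v| < d3.
      move=> d30; have d4 : 0 < d3 / (`|v| + 1) by rewrite divr_gt0.
      have h4 : \forall h \near (0 : R), `|h| < d3 / (`|v| + 1) by exact:
        nbhs0_lt.
      apply: cvg_within; near=> h; rewrite normrZ.
      have : `|h| < d3 / (`|v| + 1) by near: h.
      rewrite ltr_pdivlMr//; apply: le_lt_trans.
      by rewrite ler_wpM2l// lerDl.
    near=> h; have h0 : h != 0 by near: h; exact: nbhs_dnbhs_neq.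
    have hv1 : `|h *: v| < d1 / 2 by near: h; apply: hv0; rewrite divr_gt0.
    have Vh : V (h *: v + z) by apply: dV; near: h; exact: hv0.
    have kE : `|k h| <= 2 * `|h *: v|.
      by have := slip _ _ Vh Vz; rewrite addrK.
    have := dP (s z) (k h); rewrite subrr normr0 => /(_ d10).
    have -> : s z + k h = s (h *: v + z) by rewrite /k subrKC.
    rewrite !fs// addrK -/(k h) => /(_ (le_lt_trans kE _)) => H.
    have {}H : `|h *: v - k h *m J| <= e1 * `|k h| by apply: H; lra.
    have -> : v - h^-1 *: k h *m J = h^-1 *: (h *: v - k h *m J).
      move: (k h) => w; have -> : v = h^-1 *: (h *: v) by rewrite scalerA mulVf
        ?scale1r.
      by rewrite [in RHS]scalerA mulfV// scale1r scalerBr scalemxAl.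
    rewrite normrZ normfV ler_pdivrMl ?normr_gt0//.
    apply: le_trans H _; apply: le_trans (_ : e1 * (2 * `|h *: v|) <= _).
      by rewrite ler_pM2l.
    have eE : e1 * (2 * `|v|) + e1 * 2 = e.
      by rewrite -mulrDr -[X in _ + X]mulr1 -mulrDr /e1 divfK// mulf_neq0//
        gt_eqF.
    rewrite normrZ.
    have -> : e1 * (2 * (`|h| * `|v|)) = `|h| * (e1 * (2 * `|v|)) by ring.
    apply: ler_wpM2l => //; lra.
  have E : (fun h => h^-1 *: k h) = mulmxr (invmx J) \o (fun h =>
    (h^-1 *: k h) *m J).
    by apply/funext => h /=; rewrite mulmxK// dJ// sd//; exact: VE.
  rewrite -/J -[X in X @ _]/(fun h => h^-1 *: k h) E.
  exact: cvg_comp Jv (@mulmxr_continuous _ _ _ (invmx J) v).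
exists V, s; split=> //.
- elim=> [|k IH]; first by split.
  apply: (CkS (df := fun v z => v *m invmx (Jac f (s z)))) => // v.
  apply: Ck_mulmx => //; first exact: Ck_cst.
  apply: Ck_invmx => //; first by move=> z /VE/sd/dJ.
  by apply: (Ck_comp oV oU) => //; exact: sJ.
- have fV := sP _ (VE _ Vf).
  have := lip _ _ (sd _ (VE _ Vf)) (_ : `|y0 - y0| < d).
  rewrite fV.2 !subrr normr0 mulr0 normr_le0 subr_eq0 => H; exact/eqP/H.
- by move=> z Vz; split; [exact: sU|exact: fs].
Unshelve. all: by end_near. Qed.

(** A right inverse of the differential selects a complement on which the map
    is a local diffeomorphism. *)
Lemma local_section m n (f : 'rV[R]_m -> 'rV[R]_n) (U : set 'rV[R]_m) x0 :
  open U -> U x0 -> smooth_on U f ->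
  (forall w, exists v : 'rV[R]_m, v *m Jac f x0 = w) ->
  exists (V : set 'rV[R]_n) (s : 'rV[R]_n -> 'rV[R]_m),
  [/\ open V, V (f x0), smooth_on V s, s (f x0) = x0 &
      forall z, V z -> U (s z) /\ f (s z) = z].
Proof.
move=> oU Ux0 sf surj.
have [B BJ] : exists B : 'M[R]_(n, m), B *m Jac f x0 = 1%:M.
  have /choice[b bP] : forall i : 'I_n, exists v : 'rV[R]_m, v *m Jac f x0 =
    'e_i.
    by move=> i; exact: surj.
  exists (\matrix_i b i); apply/row_matrixP => i.
  by rewrite row_mul rowK bP row1.
pose l y := x0 + y *m B; have l0 : l 0 = x0 by rewrite /l mul0mx addr0.
have sl (W : set 'rV[R]_n) : open W -> smooth_on W l.
  move=> oW k; apply: CkD => //; first exact: Ck_cst.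
  by apply: Ck_mulmx => //; [exact: Ck_id|exact: Ck_cst].
have cl : continuous l.
  by move=> y; apply: (Ck_continuous (sl setT openT 0)).
pose U1 := l @^-1` U.
have oU1 : open U1 by move/continuousP : cl; apply.
have U10 : U1 0 by rewrite /U1 /= l0.
have sfl : smooth_on U1 (f \o l).
  by move=> k; apply: (Ck_comp oU1 oU) => //; exact: sl.
have J1 : Jac (f \o l) 0 = 1%:M.
  rewrite -BJ; apply/matrixP => i j; rewrite mxE.
  have [df Df] := C1_diff oU Ux0 (sf 1%N); rewrite -l0 in df Df.
  have dl : is_derive (0 : 'rV[R]_n) 'e_i l ('e_i *m B).
    have cB := @mulmxr_continuous _ _ _ B.
    have dB := linear_differentiable 0 cB.
    have Db : is_derive (0 : 'rV[R]_n) 'e_i (mulmxr B : 'rV[R]_n -> 'rV[R]_m)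
      ('e_i *m B).
      by apply: DeriveDef; [exact: diff_derivable|rewrite deriveE//
        (diff_lin 0 cB)].
    rewrite -['e_i *m B]add0r; exact: is_deriveD.
  have [_ ->] := is_derive_comp df dl.
  by rewrite Df /= -mulmxA l0 -rowE mxE.
have [V [s [oV Vf ss s0 Vs]]] := inverse_function oU1 U10 sfl J1.
move: Vf s0; rewrite /= l0 => Vf s0.
exists V, (l \o s); split=> [//|//|k||z /Vs Uz].
- exact: (Ck_comp oV openT (fun _ _ => I) (ss k) (sl _ openT k)).
- by rewrite /= s0 l0.
- exact: Uz.
Qed.

End InverseFunction.

(** * Smooth maps between manifolds *)

Section Manifolds.
Context {R : realType}.

Lemma open_preimage_in (V W : normedModType R) (U : set V) (N : set W) f :
  open U -> (forall x, U x -> {for x, continuous (f : V -> W)}) -> open N ->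
  open (U `&` f @^-1` N).
Proof.
move=> oU cf oN; rewrite openE => x [Ux Nfx]; apply: filterI.
  exact: open_nbhs_nbhs.
by apply: (cf _ Ux); exact: open_nbhs_nbhs.
Qed.

Lemma open_local (V : normedModType R) (U : set V) :
  (forall x, U x -> exists N, [/\ open N, N x & N `<=` U]) -> open U.
Proof.
move=> loc; rewrite openE => x /loc[N [oN Nx NU]].
by apply: filterS NU _; exact: open_nbhs_nbhs.
Qed.

Lemma smooth_comp (V : normedModType R) m p (U : set V) (U' : set 'rV[R]_m)
    (f : V -> 'rV[R]_m) (g : 'rV[R]_m -> 'rV[R]_p) :
  open U -> open U' -> (forall x, U x -> U' (f x)) ->
  smooth_on U f -> smooth_on U' g -> smooth_on U (g \o f).
Proof. by move=> oU oU' fU sf sg k; exact: (Ck_comp oU oU' fU). Qed.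

Lemma smooth_sub (V W : normedModType R) (U U' : set V) (f : V -> W) :
  U' `<=` U -> smooth_on U f -> smooth_on U' f.
Proof. by move=> UU sf k; exact: Ck_sub (sf k). Qed.

Lemma eq_smooth (V W : normedModType R) (U : set V) (f g : V -> W) :
  open U -> (forall x, U x -> f x = g x) -> smooth_on U f -> smooth_on U g.
Proof. by move=> oU fg sf k; exact: eq_Ck (sf k). Qed.

Lemma smooth_local (V W : normedModType R) (U : set V) (f : V -> W) :
  (forall x, U x -> exists N, [/\ open N, N x & smooth_on N f]) ->
  smooth_on U f.
Proof.
by move=> loc k; apply: Ck_local => x /loc[N [oN Nx sN]]; exists N; split.
Qed.

Lemma smooth_cts (V W : normedModType R) (U : set V) (f : V -> W) x :
  smooth_on U f -> U x -> {for x, continuous f}.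
Proof. by move=> sf; exact: (Ck_continuous (sf 0)). Qed.

Lemma open_smooth_preimage (V W : normedModType R) (U : set V) (N : set W)
    (f : V -> W) :
  open U -> smooth_on U f -> open N -> open (U `&` f @^-1` N).
Proof.
move=> oU sf oN; apply: open_preimage_in oN => // x Ux.
exact: smooth_cts sf Ux.
Qed.

Section SmoothMaps.
Context {X Y : Type} {n m : nat} {S : set X} {T : set Y}
  {A : set (chart R X n)} {B : set (chart R Y m)}.

Lemma cimageP (c : chart R X n) D z : is_atlas S A -> A c -> cimage c D z ->
  [/\ cdom c (cinv c z), D (cinv c z), S (cinv c z) & cmap c (cinv c z) = z].
Proof.
move=> [dA _ _] /dA[cS _ cK] [x [cx Dx] <-].
by rewrite cK ?inE//; split=> //; exact: cS.
Qed.

Lemma cimage_cmap (c : chart R X n) (D : set X) x :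
  cdom c x -> D x -> cimage c D (cmap c x).
Proof. by move=> cx Dx; exists x. Qed.

Lemma atlas_cover x : is_atlas S A -> S x -> exists2 c, A c & cdom c x.
Proof. by move=> [_ cov _] /cov[c Ac cx]; exists c. Qed.

Lemma mopen_cdom c : is_atlas S A -> A c -> mopen S A (cdom c).
Proof.
move=> [dA cov tA] Ac; split; first by have [] := dA _ Ac.
by move=> c' Ac'; have [] := tA c' c Ac' Ac.
Qed.

Lemma mopen_cimage D c : mopen S A D -> A c -> open (cimage c D).
Proof. by move=> [_ +] Ac; exact. Qed.

Lemma transition c d : is_atlas S A -> A c -> A d ->
  open (cimage c (cdom d)) /\ smooth_on (cimage c (cdom d)) (cmap d \o cinv c).
Proof. by move=> [_ _ tA] Ac Ad; exact: tA. Qed.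

Lemma cmap_cinv_id c x : is_atlas S A -> A c -> cdom c x ->
  cinv c (cmap c x) = x.
Proof. by move=> [dA _ _] /dA[_ _ cK] cx; rewrite cK// inE. Qed.

End SmoothMaps.

(** Transition maps carry the smoothness in one pair of charts around a point
    over to all others, and continuity there makes preimages open. *)
Lemma smooth_mapI X n (S : set X) (A : set (chart R X n)) Y m (T : set Y)
    (B : set (chart R Y m)) (h : X -> Y) :
  is_atlas S A -> is_atlas T B -> (forall x, S x -> T (h x)) ->
  (forall x, S x -> exists c d N,
    [/\ A c, B d, cdom c x & cdom d (h x)] /\
    [/\ open N, N (cmap c x), N `<=` cimage c (h @^-1` cdom d) &
        smooth_on N (cmap d \o h \o cinv c)]) ->
  smooth_map S A T B h.
Proof.
move=> aA aB hT loc.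
(* pass to the charts given at x by transition maps, where h is smooth *)
have key c' x D : A c' -> cdom c' x -> mopen T B D -> D (h x) -> exists N,
    [/\ open N, N (cmap c' x), N `<=` cimage c' (S `&` h @^-1` D) &
    forall d', B d' -> D `<=` cdom d' ->
      smooth_on N (cmap d' \o h \o cinv c')].
  move=> Ac' c'x mD Dhx.
  have Sx : S x by have [dA _ _] := aA; have [cS _ _] := dA _ Ac'; exact: cS.
  have [c [d [N [[Ac Bd cx dhx] [oN Nx Nc sN]]]]] := loc x Sx.
  have [oW st] := transition aA Ac' Ac.
  set W := cimage c' (cdom c) in oW st; set t := cmap c \o cinv c' in st.
  set g := cmap d \o h \o cinv c in sN.
  pose N1 := N `&` g @^-1` cimage d D.
  have oN1 : open N1.
    exact: (open_smooth_preimage oN sN (mopen_cimage mD Bd)).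
  have oN' : open (W `&` t @^-1` N1).
    by apply: (open_smooth_preimage _ st); assumption.
  have N'P z : (W `&` t @^-1` N1) z -> [/\ cdom c' (cinv c' z), S (cinv c' z),
      cmap c' (cinv c' z) = z, D (h (cinv c' z)) &
        g (t z) = cmap d (h (cinv c' z))].
    move=> [/(cimageP aA Ac')[c'z cz Sz zE] [Nt gt]].
    have gtE : g (t z) = cmap d (h (cinv c' z)).
      by rewrite /g /t /= (cmap_cinv_id aA Ac cz).
    split=> //; have [_ dz _ _] := cimageP aA Ac (Nc _ Nt).
    move: dz; rewrite /t /= (cmap_cinv_id aA Ac cz) => dz.
    have [y [dy Dy]] := gt; rewrite gtE => /(congr1 (cinv d)).
    by rewrite !(cmap_cinv_id aB Bd)// => <-.
  exists (W `&` t @^-1` N1); split=> //.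
  - split; first exact: cimage_cmap.
    rewrite /N1 /t /= !(cmap_cinv_id aA Ac' c'x); split=> //=.
    by rewrite /g /= (cmap_cinv_id aA Ac cx); exact: cimage_cmap.
  - move=> z /N'P[c'z Sz zE Dz _]; rewrite -zE.
    by apply: cimage_cmap => //; split.
  - move=> d' Bd' Dd'; have [oD sD] := transition aB Bd Bd'.
    have : smooth_on (W `&` t @^-1` N1) ((cmap d' \o cinv d) \o (g \o t)).
      apply: (smooth_comp oN' oD) => //.
      + move=> z /= [_ [_ [y [dy Dy] <-]]]; apply: cimage_cmap => //;
          exact: Dd'.
      + apply: (smooth_comp oN' oN1).
        * by move=> z [_ Nz].
        * by apply: smooth_sub st => z [].
        * by apply: smooth_sub sN => z [].
    apply: eq_smooth => // z N'z; have [c'z Sz zE Dz gE] := N'P z N'z.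
    move: gE => /= ->.
    have dz : cdom d (h (cinv c' z)).
      case: N'z => [[y [c'y cy] yz] [Nt _]].
      have [_ + _ _] := cimageP aA Ac (Nc _ Nt).
      rewrite /t /= (cmap_cinv_id aA Ac)//.
      by rewrite -yz (cmap_cinv_id aA Ac').
    by rewrite (cmap_cinv_id aB Bd).
split.
- by move=> _ [x Sx <-]; exact: hT.
- move=> D mD; split; first by move=> x [].
  move=> c Ac; apply: open_local => _ [x [cx [Sx Dx]] <-].
  by have [N [oN Nx NS _]] := key c x D Ac cx mD Dx; exists N.
- move=> c d Ac Bd; apply: smooth_local => _ [x [cx dx] <-].
  have [N [oN Nx _ sN]] := key c x _ Ac cx (mopen_cdom aB Bd) dx.
  by exists N; split=> //; exact: sN.
Qed.

Lemma smooth_map_chart X n (S : set X) (A : set (chart R X n)) Y m (T : set Y)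
    (B : set (chart R Y m)) (h : X -> Y) c d :
  is_atlas S A -> is_atlas T B -> smooth_map S A T B h -> A c -> B d ->
  open (cimage c (h @^-1` cdom d)) /\
  smooth_on (cimage c (h @^-1` cdom d)) (cmap d \o h \o cinv c).
Proof.
move=> aA aB [_ oh sh] Ac Bd; split; last exact: sh.
have := mopen_cimage (oh _ (mopen_cdom aB Bd)) Ac.
rewrite (_ : cimage c _ = cimage c (h @^-1` cdom d))//.
apply/seteqP; split=> [_ [x [cx [Sx dx]] <-]|_ [x [cx dx] <-]].
  exact: cimage_cmap.
have [dA _ _] := aA; have [cS _ _] := dA _ Ac.
by apply: cimage_cmap => //; split=> //; exact: cS.
Qed.

Lemma smooth_map_comp X n (S : set X) (A : set (chart R X n))
    Y m (T : set Y) (B : set (chart R Y m))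
    Z p (U : set Z) (C : set (chart R Z p)) (h : X -> Y) (k : Y -> Z) :
  is_atlas S A -> is_atlas T B -> is_atlas U C ->
  smooth_map S A T B h -> smooth_map T B U C k -> smooth_map S A U C (k \o h).
Proof.
move=> aA aB aC sh sk.
have hT x : S x -> T (h x) by case: sh => + _ _ Sx; apply; exists x.
have kU y : T y -> U (k y) by case: sk => + _ _ Ty; apply; exists y.
apply: smooth_mapI => // [x Sx|x Sx]; first by apply/kU/hT.
have [c Ac cx] := atlas_cover aA Sx.
have [d Bd dx] := atlas_cover aB (hT _ Sx).
have [e Ce ex] := atlas_cover aC (kU _ (hT _ Sx)).
have [oW sW] := smooth_map_chart aA aB sh Ac Bd.
have [oV sV] := smooth_map_chart aB aC sk Bd Ce.
set W := cimage c _ in oW sW; set V := cimage d _ in oV sV.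
set f := _ \o cinv c in sW; set g := _ \o cinv d in sV.
have oN : open (W `&` f @^-1` V).
  by apply: (open_smooth_preimage _ sW); assumption.
have NP z : (W `&` f @^-1` V) z -> [/\ cdom c (cinv c z), cmap c (cinv c z) = z,
   cdom d (h (cinv c z)) & cdom e (k (h (cinv c z)))].
  move=> [Wz Vz]; have [cz dz _ zE] := cimageP aA Ac Wz; split=> //.
  have [_ + _ _] := cimageP aB Bd Vz.
  by rewrite /f /= (cmap_cinv_id aB Bd).
exists c, e, (W `&` f @^-1` V); split=> //; split=> //.
- split; first exact: cimage_cmap.
  by rewrite /f /= (cmap_cinv_id aA Ac cx); exact: cimage_cmap.
- by move=> z /NP[cz zE _ ez]; rewrite -zE; exact: cimage_cmap.
- have : smooth_on (W `&` f @^-1` V) (g \o f).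
    apply: (smooth_comp oN oV) => //; first by move=> z [].
    by apply: smooth_sub sW => z [].
  apply: eq_smooth => // z /NP[cz zE dz ez].
  by rewrite /g /f /= (cmap_cinv_id aB Bd).
Qed.

Lemma eq_smooth_map X n (S : set X) (A : set (chart R X n)) Y m (T : set Y)
    (B : set (chart R Y m)) (h k : X -> Y) :
  is_atlas S A -> is_atlas T B -> (forall x, S x -> h x = k x) ->
  smooth_map S A T B h -> smooth_map S A T B k.
Proof.
move=> aA aB hk sh.
have hT x : S x -> T (h x) by case: sh => + _ _ Sx; apply; exists x.
apply: smooth_mapI => // x Sx; first by rewrite -hk//; exact: hT.
have [c Ac cx] := atlas_cover aA Sx.
have [d Bd dx] := atlas_cover aB (hT _ Sx).
have [oW sW] := smooth_map_chart aA aB sh Ac Bd.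
exists c, d, (cimage c (h @^-1` cdom d)); split; first by split=> //;
  rewrite -hk.
split=> //.
- exact: cimage_cmap.
- move=> z /(cimageP aA Ac)[cz dz Sz zE]; rewrite -zE.
  by apply: cimage_cmap => //=; rewrite -hk.
- by apply: eq_smooth sW => // z /(cimageP aA Ac)[cz dz Sz zE] /=; rewrite hk.
Qed.

(** A surjective submersion has local sections, through which smoothness
    descends to the base. *)
Lemma smooth_map_descent X n (S : set X) (A : set (chart R X n))
    Y m (T : set Y) (B : set (chart R Y m))
    Z p (U : set Z) (C : set (chart R Z p)) (h : X -> Y) (k : Y -> Z) :
  is_atlas S A -> is_atlas T B -> is_atlas U C ->
  submersion S A T B h -> T `<=` h @` S ->
  smooth_map S A U C (k \o h) -> smooth_map T B U C k.
Proof.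
move=> aA aB aC [sh subh] surj skh.
have hT x : S x -> T (h x) by case: sh => + _ _ Sx; apply; exists x.
have kU y : T y -> U (k y).
  by move=> /surj[x Sx <-]; case: skh => + _ _; apply; exists x.
apply: smooth_mapI => // y Ty.
have [x Sx xy] := surj y Ty.
have [c Ac cx] := atlas_cover aA Sx.
have [d Bd dy] := atlas_cover aB Ty.
have [e Ce ey] := atlas_cover aC (kU _ Ty).
have [oW sW] := smooth_map_chart aA aB sh Ac Bd.
have [oQ sQ] := smooth_map_chart aA aC skh Ac Ce.
have dhx : cdom d (h x) by rewrite xy.
have Wx : cimage c (h @^-1` cdom d) (cmap c x) by exact: cimage_cmap.
have sj : forall w, exists v : 'rV[R]_n,
    v *m Jac (cmap d \o h \o cinv c) (cmap c x) = w.
  move=> w; have [_ D] := C1_diff oW Wx (sW 1%N).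
  have [v _ vw] := subh c d x Ac Bd cx dhx w I.
  by exists v; rewrite -vw D.
have [V [s [oV Vx ss s0 Vs]]] := local_section oW Wx sW sj.
set f := cmap d \o h \o cinv c in sW sj Vx s0 Vs.
set q := cmap e \o (k \o h) \o cinv c in sQ.
have fx : f (cmap c x) = cmap d y by rewrite /f /= (cmap_cinv_id aA Ac cx) xy.
rewrite fx in Vx s0.
have oN : open (V `&` s @^-1` cimage c ((k \o h) @^-1` cdom e)).
  by apply: (open_smooth_preimage _ ss); assumption.
have NP z : V z -> cdom d (h (cinv c (s z))) /\ cinv d z = h (cinv c (s z)).
  move=> /Vs[Wz fz]; have [_ dz _ _] := cimageP aA Ac Wz; split=> //.
  by rewrite -[in LHS]fz /f /= (cmap_cinv_id aB Bd).
exists d, e, (V `&` s @^-1` cimage c ((k \o h) @^-1` cdom e)); split=> //;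
  split=> //.
- split=> //=; rewrite s0; apply: cimage_cmap => //=; by rewrite xy.
- move=> z [Vz /(cimageP aA Ac)[_ ez _ _]]; have [dz zE] := NP z Vz.
  have zd : cmap d (cinv d z) = z by rewrite zE; have [_] := Vs z Vz.
  by rewrite -zd; apply: cimage_cmap => //; rewrite /= zE.
- have : smooth_on (V `&` s @^-1` cimage c ((k \o h) @^-1` cdom e)) (q \o s).
    apply: (smooth_comp oN oQ) => //; first by move=> z [].
    by apply: smooth_sub ss => z [].
  by apply: eq_smooth => // z [/NP[_ zE] _]; rewrite /q /= zE.
Qed.

End Manifolds.

(** * Embedded submanifolds *)

Section EmbeddedManifolds.
Context {R : realType}.

(** Any covering family of embedded charts is allowed: the charts of a product
    are among the embedded charts of the product without exhausting them. *)
Definition embedded_atlas X N (i : X -> 'rV[R]_N) (S : set X) n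
    (A : set (chart R X n)) :=
  A `<=` embedded_charts i S n /\ S `<=` \bigcup_(c in A) cdom c.

(** Smoothness of h in the ambient coordinates i and j: one smooth extension,
    to a neighbourhood of i(S). *)
Definition ambient_smooth X N (i : X -> 'rV[R]_N) (S : set X)
    Y M (j : Y -> 'rV[R]_M) (h : X -> Y) :=
  exists (Q : set 'rV[R]_N) (F : 'rV[R]_N -> 'rV[R]_M),
  [/\ open Q, forall x, S x -> Q (i x), smooth_on Q F &
      forall x, S x -> F (i x) = j (h x)].

Section Charts.
Context {X : Type} {N : nat} {i : X -> 'rV[R]_N} {S : set X} {n : nat}
  {A : set (chart R X n)}.

Lemma embedded_cimageP (c : chart R X n) D z : embedded_charts i S n c ->
  cimage c D z -> [/\ cdom c (cinv c z), D (cinv c z) & cmap c (cinv c z) = z].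
Proof. by move=> [_ _ cK _ _] [x [cx Dx] <-]; rewrite cK// inE. Qed.

Lemma embedded_chart_ext (c : chart R X n) x : embedded_charts i S n c ->
  cdom c x -> exists (Q : set 'rV[R]_N) (F : 'rV[R]_N -> 'rV[R]_n),
    [/\ open Q, Q (i x), smooth_on Q F &
      forall y, S y -> Q (i y) -> cdom c y /\ F (i y) = cmap c y].
Proof.
move=> [[Q1 oO1 cE] _ _ _ ext] cx; have [Q2 [F [oO2 Qx sF FE]]] := ext x cx.
exists (Q1 `&` Q2), F; split.
- exact: openI.
- by split=> //; move: cx; rewrite cE => -[].
- by apply: smooth_sub sF => y [].
- move=> y Sy [Q1y Q2y]; have cy : cdom c y by rewrite cE; split.
  by split=> //; exact: FE.
Qed.

Lemma embedded_cinv_smooth c : embedded_charts i S n c ->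
  open (cimage c setT) /\ smooth_on (cimage c setT) (i \o cinv c).
Proof. by case. Qed.

(** Transition maps are smooth since the chart map of d extends to the ambient
    space, where it is composed with the smooth inverse of c. *)
Lemma embedded_is_atlas : embedded_atlas i S A -> is_atlas S A.
Proof.
move=> [AE cov]; split=> //.
  move=> c /AE[[Q oO cE] oi cK _ _]; split=> //.
  by rewrite cE => x [].
move=> c d /AE Ec /AE Ed; have [oc sc] := embedded_cinv_smooth Ec.
have Sc x : cdom c x -> S x by case: Ec => -[Q oO ->] _ _ _ _ [].
have cK x : cdom c x -> cinv c (cmap c x) = x.
  by case: Ec => _ _ cK _ _ cx; rewrite cK// inE.
have loc z : cimage c (cdom d) z -> exists M, [/\ open M, M z,
    M `<=` cimage c (cdom d) & smooth_on M (cmap d \o cinv c)].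
  move=> [x [cx dx] <-] {z}; have [Q [F [oO Qx sF FE]]] :=
    embedded_chart_ext Ed dx.
  pose M := cimage c setT `&` (i \o cinv c) @^-1` Q.
  have oM : open M.
    by apply: (open_smooth_preimage _ sc); assumption.
  have MP z : M z -> [/\ cdom c (cinv c z), cdom d (cinv c z),
      cmap c (cinv c z) = z & F (i (cinv c z)) = cmap d (cinv c z)].
    move=> [/(embedded_cimageP Ec)[cz _ zE] Qz].
    by have [dz FzE] := FE _ (Sc _ cz) Qz.
  exists M; split=> //.
  - by split; [exact: cimage_cmap|rewrite /= cK].
  - by move=> z /MP[cz dz zE _]; rewrite -zE; exact: cimage_cmap.
  - have : smooth_on M (F \o (i \o cinv c)).
      apply: (smooth_comp oM oO) => //; first by move=> z [].
      by apply: smooth_sub sc => z [].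
    by apply: eq_smooth => // z /MP[].
split.
  by apply: open_local => z /loc[M [oM Mz Mc _]]; exists M.
by apply: smooth_local => z /loc[M [oM Mz _ sM]]; exists M.
Qed.

End Charts.

Lemma embedded_smooth_map X N (i : X -> 'rV[R]_N) (S : set X) n
    (A : set (chart R X n)) Y M (j : Y -> 'rV[R]_M) (T : set Y) m
    (B : set (chart R Y m)) (h : X -> Y) :
  embedded_atlas i S A -> embedded_atlas j T B -> (forall x, S x -> T (h x)) ->
  ambient_smooth i S j h -> smooth_map S A T B h.
Proof.
move=> EA EB hT [Q1 [F1 [oO1 SO sF1 F1E]]].
have aA := embedded_is_atlas EA; have aB := embedded_is_atlas EB.
apply: smooth_mapI => // x Sx.
have [c Ac cx] := atlas_cover aA Sx; have [d Bd dx] := atlas_cover aB (hT _ Sx).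
have [oc sc] := embedded_cinv_smooth (EA.1 _ Ac).
have [Q2 [F2 [oO2 Qx sF2 F2E]]] := embedded_chart_ext (EB.1 _ Bd) dx.
have oO12 : open (Q1 `&` F1 @^-1` Q2).
  by apply: (open_smooth_preimage _ sF1); assumption.
pose P := cimage c setT `&` (i \o cinv c) @^-1` (Q1 `&` F1 @^-1` Q2).
have oP : open P.
  by apply: (open_smooth_preimage _ sc); assumption.
have PP z : P z -> [/\ cdom c (cinv c z), cdom d (h (cinv c z)),
    cmap c (cinv c z) = z & F2 (F1 (i (cinv c z))) = cmap d (h (cinv c z))].
  move=> [/(cimageP aA Ac)[cz _ Sz zE] [_ /=]]; rewrite F1E// => Q2z.
  by have [dz FE] := F2E _ (hT _ Sz) Q2z.
exists c, d, P; split=> //; split=> //.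
- split; first exact: cimage_cmap.
  by rewrite /= (cmap_cinv_id aA Ac cx); split; [exact: SO|rewrite /= F1E].
- by move=> z /PP[cz dz zE _]; rewrite -zE; exact: cimage_cmap.
- have : smooth_on P ((F2 \o F1) \o (i \o cinv c)).
    apply: (smooth_comp oP oO12); first by move=> z [].
      by apply: smooth_sub sc => z [].
    apply: (smooth_comp oO12 oO2) => //; first by move=> z [].
    by apply: smooth_sub sF1 => z [].
  by apply: eq_smooth => // z /PP[].
Qed.

(** The way to chart a set given by a parametrisation, such as Sp(1,1) by its
    product decomposition. *)
Lemma embedded_chart_pullback X N (i : X -> 'rV[R]_N) (S : set X)
    Y M (j : Y -> 'rV[R]_M) (T : set Y) m (d : chart R Y m)
    (f : X -> Y) (g : Y -> X) :
  embedded_charts j T m d ->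
  (forall x, S x -> T (f x)) -> (forall y, T y -> S (g y)) ->
  (forall x, S x -> g (f x) = x) -> (forall y, T y -> f (g y) = y) ->
  ambient_smooth i S j f -> ambient_smooth j T i g ->
  embedded_charts i S m
    (Chart (S `&` f @^-1` cdom d) (cmap d \o f) (g \o cinv d)).
Proof.
move=> Ed fT gS fK gK [Q1 [F1 [oO1 SO sF1 F1E]]] [Q2 [F2 [oO2 TO sF2 F2E]]].
have [[Q3 oO3 dE] od dK sd ext] := Ed.
have imE : cimage (Chart (S `&` f @^-1` cdom d) (cmap d \o f) (g \o cinv d))
  setT
    = cimage d setT.
  apply/seteqP; split=> [_ [x [[Sx dx] _] <-]|_ [y [dy _] <-]].
    by exists (f x).
  have Ty : T y by move: dy; rewrite dE => -[].
  exists (g y); last by rewrite /= gK.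
  by do 2?split=> //; [exact: gS|rewrite /= gK].
have oO13 : open (Q1 `&` F1 @^-1` Q3).
  by apply: (open_smooth_preimage _ sF1); assumption.
split.
- exists (Q1 `&` F1 @^-1` Q3) => //=; rewrite dE; apply/seteqP; split=> x /=.
    by move=> [Sx [Tx Q3x]]; split=> //; split; [exact: SO|rewrite /= F1E].
  by move=> [Sx [Q1x]]; rewrite F1E// => Q3x; split=> //; split=> //; exact: fT.
- by rewrite imE.
- by move=> x /=; rewrite inE => -[Sx dx] /=; rewrite dK ?inE// fK.
- rewrite imE /=.
  have TP z : cimage d setT z -> T (cinv d z).
    by move=> /(embedded_cimageP Ed)[+ _ _]; rewrite dE => -[].
  have : smooth_on (cimage d setT) (F2 \o (j \o cinv d)).
    by apply: (smooth_comp od oO2) => // z /TP Tz; exact: TO.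
  by apply: eq_smooth => // z /TP Tz; rewrite /= F2E.
- move=> x /= [Sx dx]; have [Q4 [F4 [oO4 Qx sF4 FE]]] :=
    embedded_chart_ext Ed dx.
  have oO14 : open (Q1 `&` F1 @^-1` Q4).
    by apply: (open_smooth_preimage _ sF1); assumption.
  exists (Q1 `&` F1 @^-1` Q4), (F4 \o F1); split=> //.
  + by split; [exact: SO|rewrite /= F1E].
  + apply: (smooth_comp oO14 oO4) => //; first by move=> z [].
    by apply: smooth_sub sF1 => z [].
  + move=> y [Sy dy] [_ /=]; rewrite F1E// => Q4y.
    by have [_] := FE _ (fT _ Sy) Q4y.
Qed.

Section Blocks.
Context {V : normedModType R}.

Lemma Ck_row_mx k (U : set V) m n p (f : V -> 'M[R]_(m, n)) (g : V ->
  'M[R]_(m, p)) :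
  open U -> Ck k U f -> Ck k U g -> Ck k U (fun x => row_mx (f x) (g x)).
Proof.
move=> oU Cf Cg; apply/Ck_mxP => // i j; case: (split_ordP j) => j' ->.
  by apply: eq_Ck ((Ck_mxP _ _ oU).1 Cf i j') => // x _; rewrite row_mxEl.
by apply: eq_Ck ((Ck_mxP _ _ oU).1 Cg i j') => // x _; rewrite row_mxEr.
Qed.

Lemma Ck_lsubmx k (U : set V) m n p (f : V -> 'M[R]_(m, n + p)) :
  open U -> Ck k U f -> Ck k U (fun x => lsubmx (f x)).
Proof.
move=> oU Cf; apply/Ck_mxP => // i j.
by apply: eq_Ck ((Ck_mxP _ _ oU).1 Cf i (lshift p j)) => // x _; rewrite mxE.
Qed.

Lemma Ck_rsubmx k (U : set V) m n p (f : V -> 'M[R]_(m, n + p)) :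
  open U -> Ck k U f -> Ck k U (fun x => rsubmx (f x)).
Proof.
move=> oU Cf; apply/Ck_mxP => // i j.
by apply: eq_Ck ((Ck_mxP _ _ oU).1 Cf i (rshift n j)) => // x _; rewrite mxE.
Qed.

End Blocks.

Definition prod_emb X N (i : X -> 'rV[R]_N) Y M (j : Y -> 'rV[R]_M)
  (xy : X * Y) : 'rV[R]_(N + M) := row_mx (i xy.1) (j xy.2).

Lemma smooth_lsubmx n m (U : set 'rV[R]_(n + m)) : open U ->
  smooth_on U (lsubmx : 'rV[R]_(n + m) -> 'rV[R]_n).
Proof. by move=> oU k; apply: Ck_lsubmx => //; exact: Ck_id. Qed.

Lemma smooth_rsubmx n m (U : set 'rV[R]_(n + m)) : open U ->
  smooth_on U (rsubmx : 'rV[R]_(n + m) -> 'rV[R]_m).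
Proof. by move=> oU k; apply: Ck_rsubmx => //; exact: Ck_id. Qed.

Lemma open_block n m (U : set 'rV[R]_n) (V : set 'rV[R]_m) : open U -> open V ->
  open [set z : 'rV[R]_(n + m) | U (lsubmx z) /\ V (rsubmx z)].
Proof.
move=> oU oV.
have cl := fun x => smooth_cts (smooth_lsubmx openT)
  (I : [set: 'rV[R]_(n + m)] x).
have cr := fun x => smooth_cts (smooth_rsubmx openT)
  (I : [set: 'rV[R]_(n + m)] x).
by apply: openI; [move/continuousP : cl|move/continuousP : cr]; apply.
Qed.

Lemma smooth_block n m n' m' (U : set 'rV[R]_n) (V : set 'rV[R]_m)
    (f : 'rV[R]_n -> 'rV[R]_n') (g : 'rV[R]_m -> 'rV[R]_m') :
  open U -> open V -> smooth_on U f -> smooth_on V g ->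
  smooth_on [set z : 'rV[R]_(n + m) | U (lsubmx z) /\ V (rsubmx z)]
    (fun z => row_mx (f (lsubmx z)) (g (rsubmx z))).
Proof.
move=> oU oV sf sg k; have oUV := open_block oU oV; apply: Ck_row_mx => //.
  by apply: (Ck_comp oUV oU _ (smooth_lsubmx oUV k) (sf k)) => z [].
by apply: (Ck_comp oUV oV _ (smooth_rsubmx oUV k) (sg k)) => z [].
Qed.

Lemma prod_chart_embedded X N (i : X -> 'rV[R]_N) (S : set X) n c
    Y M (j : Y -> 'rV[R]_M) (T : set Y) m d :
  embedded_charts i S n c -> embedded_charts j T m d ->
  embedded_charts (prod_emb i j) (S `*` T) (n + m) (prod_chart c d).
Proof.
move=> Ec Ed; have [[Q1 oO1 cE] oc cK sc _] := Ec.
have [[Q2 oO2 dE] od dK sd _] := Ed.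
have imE : cimage (prod_chart c d) setT =
    [set z | cimage c setT (lsubmx z) /\ cimage d setT (rsubmx z)].
  apply/seteqP; split=> [_ [[x y] [[/= cx dy] _] <-]|z
    [[x [cx _] xz] [y [dy _] yz]]].
    by rewrite /= row_mxKl row_mxKr; split; exact: cimage_cmap.
  by exists (x, y) => //=; rewrite xz yz hsubmxK.
split.
- exists [set z | Q1 (lsubmx z) /\ Q2 (rsubmx z)]; first exact: open_block.
  apply/seteqP; split=> -[x y] /=; rewrite /prod_emb /= row_mxKl row_mxKr cE dE.
    by move=> [[? ?] [? ?]].
  by move=> [[? ?] [? ?]].
- by rewrite imE; exact: open_block.
- move=> [x y]; rewrite inE /= => -[cx dy].
  by rewrite row_mxKl row_mxKr cK ?inE// dK ?inE.
- by rewrite imE; exact: (smooth_block oc od sc sd).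
- move=> [x y] /= [cx dy].
  have [Q3 [F [oO3 Qx sF FE]]] := embedded_chart_ext Ec cx.
  have [Q4 [G [oO4 Qy sG GE]]] := embedded_chart_ext Ed dy.
  exists [set z | Q3 (lsubmx z) /\ Q4 (rsubmx z)].
  exists (fun z => row_mx (F (lsubmx z)) (G (rsubmx z))); split.
  + exact: open_block.
  + by rewrite /prod_emb /= row_mxKl row_mxKr.
  + exact: smooth_block.
  + move=> [x' y'] /= [cx' dy']; rewrite /prod_emb /= row_mxKl row_mxKr.
    move=> [Q3x Q4y]; move: cx' dy'; rewrite cE dE => -[Sx _] [Ty _].
    by have [_ ->] := FE _ Sx Q3x; have [_ ->] := GE _ Ty Q4y.
Qed.

Lemma prod_embedded_atlas X N (i : X -> 'rV[R]_N) (S : set X) n A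
    Y M (j : Y -> 'rV[R]_M) (T : set Y) m B :
  embedded_atlas i S (A : set (chart R X n)) ->
  embedded_atlas j T (B : set (chart R Y m)) ->
  embedded_atlas (prod_emb i j) (S `*` T) (prod_charts A B).
Proof.
move=> [EA cA] [EB cB]; split.
  by move=> _ [[c d] /= [Ac Bd] <-]; apply: prod_chart_embedded;
    [exact: EA|exact: EB].
move=> [x y] /= [/cA[c Ac cx] /cB[d Bd dy]].
by exists (prod_chart c d) => //; exists (c, d).
Qed.

Lemma Rn_embedded_atlas n : embedded_atlas id setT (@Rn_charts R n).
Proof.
split=> [_ ->|x _]; last by exists (Chart setT id id).
have im : cimage (Chart setT id id : chart R 'rV[R]_n n) setT = setT.
  by apply/seteqP; split=> // x _; exists x.
split=> //.
- by exists setT; [exact: openT|rewrite setTI].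
- by rewrite im; exact: openT.
- by rewrite im => k; apply: Ck_id; exact: openT.
- move=> x _; exists setT, id; split=> //; first exact: openT.
  by move=> k; apply: Ck_id; exact: openT.
Qed.

End EmbeddedManifolds.

(** * Quaternions *)

Section QuaternionCoordinates.
Context {R : realType}.
Implicit Types p q r : quat R.

Lemma qcM p q :
  (qc (p * q) 0 = qc p 0 * qc q 0 - qc p 1 * qc q 1 - qc p 2 * qc q 2 -
    qc p 3 * qc q 3) *
  (qc (p * q) 1 = qc p 0 * qc q 1 + qc p 1 * qc q 0 + qc p 2 * qc q 3 -
    qc p 3 * qc q 2) *
  (qc (p * q) 2 = qc p 0 * qc q 2 - qc p 1 * qc q 3 + qc p 2 * qc q 0 +
    qc p 3 * qc q 1) *
  (qc (p * q) 3 = qc p 0 * qc q 3 + qc p 1 * qc q 2 - qc p 2 * qc q 1 +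
    qc p 3 * qc q 0).
Proof. by have -> : p * q = qmul p q by []; rewrite !qc_mkquat. Qed.

Lemma qc1 : (qc (1 : quat R) 0 = 1) * (qc (1 : quat R) 1 = 0) *
  (qc (1 : quat R) 2 = 0) * (qc (1 : quat R) 3 = 0).
Proof. by have -> : 1 = qone :> quat R by []; rewrite !qc_mkquat. Qed.

Lemma qcN q i : qc (- q) i = - qc q i.
Proof. by rewrite /qc mxE. Qed.

Lemma qc_conj q : (qc (qconj q) 0 = qc q 0) * (qc (qconj q) 1 = - qc q 1) *
  (qc (qconj q) 2 = - qc q 2) * (qc (qconj q) 3 = - qc q 3).
Proof. by rewrite !qc_mkquat. Qed.

Definition qcE := (@qcD R, qcN, @qcZ R, @qc0 R, qc1, qc_conj, qcM, @qc_mkquat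
  R).

End QuaternionCoordinates.

Ltac quat_ring := apply: quatP; rewrite !qcE; ring.

Section QuaternionAlgebra.
Context {R : realType}.
Implicit Types p q r : quat R.

Lemma qscaleAl (a : R) p q : (a *: p) * q = a *: (p * q).
Proof. by quat_ring. Qed.

Lemma qscaleAr (a : R) p q : p * (a *: q) = a *: (p * q).
Proof. by quat_ring. Qed.

Lemma qconjM p q : qconj (p * q) = qconj q * qconj p.
Proof. by quat_ring. Qed.

Lemma qconjK p : qconj (qconj p) = p.
Proof. by quat_ring. Qed.

Lemma qconjN p : qconj (- p) = - qconj p.
Proof. by quat_ring. Qed.

Lemma qconjD p q : qconj (p + q) = qconj p + qconj q.
Proof. by quat_ring. Qed.

Lemma qconjZ (a : R) p : qconj (a *: p) = a *: qconj p.
Proof. by quat_ring. Qed.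

Lemma qconj0 : qconj 0 = 0 :> quat R.
Proof. by quat_ring. Qed.

Lemma qconj1 : qconj 1 = 1 :> quat R.
Proof. by quat_ring. Qed.

Lemma qmul_conj p : p * qconj p = (qnorm p ^+ 2) *: (1 : quat R).
Proof. rewrite qnormE; by quat_ring. Qed.

Lemma qconj_mul p : qconj p * p = (qnorm p ^+ 2) *: (1 : quat R).
Proof. rewrite qnormE; by quat_ring. Qed.

Lemma qnorm_ge0 p : 0 <= qnorm p.
Proof. exact: sqrtr_ge0. Qed.

Lemma qnorm_eqP p q : reflect (qnorm p = qnorm q) (qnorm p ^+ 2 == qnorm q ^+
  2).
Proof. by rewrite eqrXn2 ?qnorm_ge0//; exact: eqP. Qed.

Lemma qnormM p q : qnorm (p * q) = qnorm p * qnorm q.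
Proof.
apply/eqP; rewrite -(@eqrXn2 _ 2)// ?mulr_ge0 ?qnorm_ge0//.
rewrite exprMn !qnormE !qcE; apply/eqP; ring.
Qed.

Lemma qnorm_conj p : qnorm (qconj p) = qnorm p.
Proof. by apply/qnorm_eqP; rewrite !qnormE !qcE; apply/eqP; ring. Qed.

Lemma qnorm1 : qnorm (1 : quat R) = 1.
Proof.
by apply/eqP; rewrite -(@eqrXn2 _ 2)// ?qnorm_ge0// qnormE !qcE; apply/eqP;
  ring.
Qed.

Lemma qnormZ (a : R) p : qnorm (a *: p) ^+ 2 = a ^+ 2 * qnorm p ^+ 2.
Proof. rewrite !qnormE !qcE; ring. Qed.

Lemma qnorm0 : qnorm (0 : quat R) = 0.
Proof.
by apply/eqP; rewrite -(@eqrXn2 _ 2)// ?qnorm_ge0// qnormE !qcE; apply/eqP;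
  ring.
Qed.

Lemma qnorm_eq0 p : (qnorm p == 0) = (p == 0).
Proof.
apply/idP/eqP => [p0|->]; last by rewrite qnorm0.
by apply/eqP; apply: contraTT p0 => /qnorm2_neq0; rewrite sqrf_eq0.
Qed.

Lemma qinvE p : p^-1 = (qnorm p ^+ 2)^-1 *: qconj p.
Proof. by []. Qed.

Lemma qunitE p : (p \is a GRing.unit) = (p != 0).
Proof. by []. Qed.

Lemma qmulV p : p != 0 -> p * p^-1 = 1.
Proof. exact: (@mulrV (quat R)). Qed.

Lemma qVmul p : p != 0 -> p^-1 * p = 1.
Proof. exact: (@mulVr (quat R)). Qed.

Lemma qinvZ (a : R) p : (a *: p)^-1 = a^-1 *: p^-1.
Proof.
rewrite !qinvE qnormZ qconjZ !scalerA; congr (_ *: _).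
have [->|a0] := eqVneq a 0; first by rewrite mulr0 invr0 mul0r.
by rewrite invfM (expr2 a) invfM mulrAC -(mulrA a^-1) mulVf// mulr1.
Qed.

Lemma sphere3E : sphere 3 = Sp1 :> set (quat R).
Proof.
apply/seteqP; split=> q; rewrite /sphere /Sp1 /= /qnorm => H.
  by rewrite H sqrtr1.
have : Num.sqrt (\sum_(i < 4) q ord0 i ^+ 2) ^+ 2 = 1 by rewrite H expr1n.
by rewrite sqr_sqrtr// sumr_ge0// => i _; rewrite sqr_ge0.
Qed.

Lemma Sp1P (q : quat R) : Sp1 q <-> qnorm q ^+ 2 = 1.
Proof.
split=> [->|q1]; first by rewrite expr1n.
by apply/eqP; rewrite -(@eqrXn2 _ 2)// ?qnorm_ge0// q1 expr1n.
Qed.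

Lemma qballP (q : quat R) : qball q <-> qnorm q ^+ 2 < 1.
Proof. by rewrite /qball /= expr_lt1// qnorm_ge0. Qed.

Lemma Sp1_conj (u : quat R) : Sp1 u -> Sp1 (qconj u).
Proof. by rewrite /Sp1 /= qnorm_conj. Qed.

Lemma Sp1_mul (u v : quat R) : Sp1 u -> Sp1 v -> Sp1 (u * v).
Proof. by rewrite /Sp1 /= qnormM => -> ->; rewrite mulr1. Qed.

Lemma Sp1_1 : Sp1 (1 : quat R).
Proof. exact: qnorm1. Qed.

Lemma Sp1_mulV (u : quat R) : Sp1 u -> u * qconj u = 1.
Proof. by move=> u1; rewrite qmul_conj u1 expr1n scale1r. Qed.

Lemma Sp1_Vmul (u : quat R) : Sp1 u -> qconj u * u = 1.
Proof. by move=> u1; rewrite qconj_mul u1 expr1n scale1r. Qed.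

End QuaternionAlgebra.

Section QuaternionSmooth.
Context {R : realType} {V : normedModType R}.
Implicit Types (f g : V -> quat R) (U : set V).
Local Notation Ckr k U f := (Ck k U (f : _ -> R)).

Lemma Ck_qc k U f i : open U -> Ck k U f -> Ckr k U (fun x => qc (f x) i).
Proof. by move=> oU Cf; exact: (Ck_mxP k (f : V -> 'rV[R]_4) oU).1. Qed.

Lemma Ck_mkquat k U (a b c d : V -> R) : open U ->
  Ckr k U a -> Ckr k U b -> Ckr k U c -> Ckr k U d ->
  Ck k U (fun x => mkquat (a x) (b x) (c x) (d x)).
Proof.
move=> oU Ca Cb Cc Cd.
apply: (Ck_mxP k (fun x => mkquat (a x) (b x) (c x) (d x) : 'rV[R]_4) oU).2 =>
  i j.
have E x : mkquat (a x) (b x) (c x) (d x) i j = [:: a x; b x; c x; d x]`_j.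
  by rewrite mxE.
case: j E => -[|[|[|[|//]]]] j4 E.
- by apply: eq_Ck Ca => // x _; rewrite E.
- by apply: eq_Ck Cb => // x _; rewrite E.
- by apply: eq_Ck Cc => // x _; rewrite E.
- by apply: eq_Ck Cd => // x _; rewrite E.
Qed.

Lemma Ck_qmul k U f g : open U -> Ck k U f -> Ck k U g ->
  Ck k U (fun x => f x * g x).
Proof.
move=> oU Cf Cg; have qf i := Ck_qc i oU Cf; have qg i := Ck_qc i oU Cg.
have fg i j := CkM oU (qf i) (qg j).
by apply: Ck_mkquat => //; do ?[apply: CkB => //|apply: CkD => //].
Qed.

Lemma Ck_qconj k U f : open U -> Ck k U f -> Ck k U (fun x => qconj (f x)).
Proof.
move=> oU Cf; have qf i := Ck_qc i oU Cf.
by apply: Ck_mkquat => //; apply: CkN.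
Qed.

Lemma Ck_qnorm2 k U f : open U -> Ck k U f ->
  Ckr k U (fun x => qnorm (f x) ^+ 2).
Proof.
move=> oU Cf; have qf i := Ck_qc i oU Cf; have ff i := CkM oU (qf i) (qf i).
have : Ckr k U (fun x => qc (f x) 0 * qc (f x) 0 + qc (f x) 1 * qc (f x) 1 +
    qc (f x) 2 * qc (f x) 2 + qc (f x) 3 * qc (f x) 3).
  by do ?apply: CkD => //.
by apply: eq_Ck => // x _; rewrite qnormE !expr2.
Qed.

Lemma Ck_qscale k U (a : V -> R) f : open U -> Ckr k U a -> Ck k U f ->
  Ck k U (fun x => a x *: f x).
Proof.
move=> oU Ca Cf; have qf i := CkM oU Ca (Ck_qc i oU Cf).
have : Ck k U (fun x => mkquat (a x * qc (f x) 0) (a x * qc (f x) 1)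
    (a x * qc (f x) 2) (a x * qc (f x) 3)) by exact: Ck_mkquat.
by apply: eq_Ck => // x _; apply: quatP; rewrite !qcE.
Qed.

Lemma Ck_qinv k U f : open U -> (forall x, U x -> f x != 0) -> Ck k U f ->
  Ck k U (fun x => (f x)^-1).
Proof.
move=> oU f0 Cf; apply: Ck_qscale => //; last exact: Ck_qconj.
apply: CkV => //; last exact: Ck_qnorm2.
by move=> x /f0; exact: qnorm2_neq0.
Qed.

End QuaternionSmooth.

(** * Power series and star products *)

Section PowerSeries.
Context {R : realType}.

(** Convergence at 1/2 bounds the n-th term at t by M (2t)^n, so that the sum of
    the terms of positive degree is at most 4Mt for t <= 1/4; hence so is the
    head, and t tends to 0. *)
Lemma real_series_head (x : nat -> R) :
  (forall t : R, 0 < t < 1 -> series (fun n => t ^+ n * x n) @ \oo --> (0 : R))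
    ->
  x 0%N = 0.
Proof.
move=> H; have [M M0 xM] : exists2 M : R, 0 < M & forall n, `|2^-1 ^+
  n * x n| <= M.
  have h : 0 < (2^-1 : R) < 1 by rewrite invr_gt0 ltr0n/= invf_lt1// ltr1n.
  have /cvg_series_cvg_0 c0 : cvgn (series (fun n => 2^-1 ^+ n * x n)).
    by apply/cvg_ex; exists 0; exact: H.
  have /cvg_seq_bounded/pinfty_ex_gt0[M M0 /= uM] :
      cvgn (fun n => 2^-1 ^+ n * x n) by apply/cvg_ex; exists 0.
  by exists M => // n; exact: uM.
have tail t : 0 < t -> t <= 4^-1 -> forall N : nat,
    `|series (fun n => t ^+ n * x n) N.+1 - x 0%N| <= 4 * M * t *
      (1 - 2^-1 ^+ N).
  move=> t0 t4; elim=> [|N IH].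
    by rewrite /series/= big_nat1 !expr0 mul1r !subrr normr0 mulr0.
  have -> : series (fun n => t ^+ n * x n) N.+2 - x 0%N =
      (series (fun n => t ^+ n * x n) N.+1 - x 0%N) + t ^+ N.+1 * x N.+1.
    by rewrite /series/= [in LHS]big_nat_recr//= addrAC.
  apply: le_trans (ler_normD _ _) _.
  have tx : `|t ^+ N.+1 * x N.+1| <= M * (2 * t) ^+ N.+1.
    have -> : t ^+ N.+1 * x N.+1 = (2 * t) ^+ N.+1 * (2^-1 ^+ N.+1 * x N.+1).
      by rewrite mulrA -exprMn mulrAC mulfV ?mul1r// pnatr_eq0.
    have tN : 0 <= (2 * t) ^+ N.+1 by rewrite exprn_ge0// mulr_ge0// ltW.
    by rewrite normrM (ger0_norm tN) (mulrC M) ler_wpM2l.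
  have t2 : (2 * t) ^+ N.+1 <= 2 * t * 2^-1 ^+ N.
    have h2 : (2 * t) ^+ N <= 2^-1 ^+ N by apply: lerXn2r; rewrite ?nnegrE; lra.
    by rewrite exprS ler_wpM2l// mulr_ge0// ltW.
  have : M * (2 * t) ^+ N.+1 <= M * (2 * t * 2^-1 ^+ N) by rewrite ler_pM2l.
  move: IH tx; rewrite [2^-1 ^+ N.+1]exprS; lra.
have bound t : 0 < t -> t <= 4^-1 -> `|x 0%N| <= 4 * M * t.
  move=> t0 t4; have t1 : 0 < t < 1 by rewrite t0/=; lra.
  have c := H t t1.
  apply/ler_addgt0Pr => e e0.
  have /cvgrPdist_lt/(_ e e0)[N _ NP] := c.
  have := NP N.+1 (leqnSn N); rewrite sub0r normrN => sN.
  have := tail t t0 t4 N.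
  have p0 : 0 <= 2^-1 ^+ N :> R by rewrite exprn_ge0// invr_ge0.
  have MT0 : 0 <= 4 * M * t * 2^-1 ^+ N by rewrite mulr_ge0// mulr_ge0 ?ltW//
    mulr_gt0.
  have := ler_normB (series (fun n => t ^+ n * x n) N.+1)
     (series (fun n => t ^+ n * x n) N.+1 - x 0%N).
  rewrite subKr; lra.
apply/eqP; rewrite -normr_eq0 eq_le normr_ge0 andbT.
apply/ler_addgt0Pr => e e0; rewrite add0r.
pose t := Num.min 4^-1 (e / (4 * M)).
have t0 : 0 < t by rewrite lt_min invr_gt0 ltr0n/= divr_gt0// mulr_gt0.
apply: le_trans (bound t t0 _) _; first by rewrite ge_min lexx.
rewrite mulrC -ler_pdivlMr ?mulr_gt0//.
by rewrite ge_min lexx orbT.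
Qed.

Lemma real_powser_eq0 (x : nat -> R) :
  (forall t : R, 0 < t < 1 -> series (fun n => t ^+ n * x n) @ \oo --> (0 : R))
    ->
  forall n, x n = 0.
Proof.
move=> H n; elim: n x H => [|n IH] x H; first exact: real_series_head.
apply: (IH (fun k => x k.+1)) => t t01; have x0 := real_series_head H.
have t0 : t != 0 by rewrite gt_eqF//; case/andP: t01.
have E : series (fun k => t ^+ k * x k.+1) =
    (fun N => t^-1 * series (fun k => t ^+ k * x k) N.+1).
  apply/funext => N; rewrite /series/= [in RHS]big_nat_recl//= x0 mulr0 add0r.
  rewrite mulr_sumr; apply: eq_bigr => k _.
  by rewrite exprS -!mulrA mulKf.
rewrite E -(mulr0 t^-1); apply: cvgM; first exact: cvg_cst.
by have := H t t01; rewrite -cvg_shiftS.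
Qed.

Lemma quat_cvgP T (F : set_system T) (FF : Filter F) (f : T -> quat R)
  (l : quat R) :
  f @ F --> l <-> forall i, (i < 4)%N -> (fun x => qc (f x) i) @ F --> qc l i.
Proof.
split=> [fl i _|fl].
  by have /cvg_coordP := (fl : (f : T -> 'rV[R]_4) @ F --> (l : 'rV[R]_4));
    exact.
apply: (cvg_coordP _ (f : T -> 'rV[R]_4) (l : 'rV[R]_4)).2 => i j.
rewrite (ord1 i); have := fl _ (ltn_ord j); rewrite /qc inord_val; exact.
Qed.

Lemma qc_sum n (F : nat -> quat R) i :
  qc (\sum_(0 <= k < n) F k) i = \sum_(0 <= k < n) qc (F k) i.
Proof. by rewrite /qc summxE. Qed.

(** At a real point the series splits into four real power series, one for each
    coordinate. *)
Lemma powser_unique (a b : nat -> quat R) (f : quat R -> quat R) :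
  (forall q, qball q -> series (fun n => q ^+ n * a n) @ \oo --> f q) ->
  (forall q, qball q -> series (fun n => q ^+ n * b n) @ \oo --> f q) -> a = b.
Proof.
move=> fa fb; apply/funext => n; apply/eqP; rewrite -subr_eq0; apply/eqP.
have X (t : R) k (c : quat R) : (t *: (1 : quat R)) ^+ k * c = t ^+ k *: c.
  elim: k c => [|k IH] c; first by rewrite !expr0 mul1r scale1r.
  by rewrite exprS -mulrA IH qscaleAl mul1r scalerA exprS.
suff Z i : (i < 4)%N -> forall n, qc (a n - b n) i = 0.
  by apply: quatP; rewrite qc0; apply: Z.
move=> i4; apply: real_powser_eq0 => t /andP[t0 t1].
have tB : qball (t *: (1 : quat R)).
  by apply/qballP; rewrite qnormZ qnorm1 expr1n mulr1 expr_lt1// ltW.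
have := fb _ tB; move/quat_cvgP => /(_ _ i4) cb.
have := fa _ tB; move/quat_cvgP => /(_ _ i4) ca.
set q := t *: _ in tB ca cb.
have -> : series (fun n => t ^+ n * qc (a n - b n) i) =
    (fun N => qc (series (fun n => q ^+ n * a n) N) i) -
    (fun N => qc (series (fun n => q ^+ n * b n) N) i).
  apply/funext => N; rewrite !fctE /series/= !qc_sum -sumrB.
  by apply: eq_bigr => k _; rewrite !X !qcE mulrBr.
by rewrite -(subrr (qc (f q) i)); exact: cvgB.
Qed.

Lemma coefs_eq (f : quat R -> quat R) a :
  (forall q, qball q -> series (fun n => q ^+ n * a n) @ \oo --> f q) ->
  coefs f = a.
Proof.
move=> fa; rewrite /coefs; case: xgetP => [b _ fb|/(_ a)/(_ fa)//].
exact: powser_unique fb fa.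
Qed.

Lemma powser3_cvg (a : nat -> quat R) q : (forall n, a n.+3 = 0) ->
  series (fun n => q ^+ n * a n) @ \oo --> a 0%N + q * a 1%N + q ^+ 2 * a 2%N.
Proof.
move=> a0; apply: cvg_near_cst; exists 3%N => // -[|[|[|n]]]// _;
  rewrite /series/= big_nat_recl// big_nat_recl// big_nat_recl//=.
rewrite big1_seq ?addr0 => [|k _]; last by rewrite a0 mulr0.
by rewrite expr0 mul1r expr1 addrA.
Qed.

Lemma powser3E (a : nat -> quat R) q : (forall n, a n.+3 = 0) -> qball q ->
  powser a q = a 0%N + q * a 1%N + q ^+ 2 * a 2%N.
Proof.
move=> a0 qB; rewrite /powser mem_set//; apply: cvg_lim => //.
exact: powser3_cvg.
Qed.

Lemma qmulr_continuous (v : quat R) : continuous (fun x : quat R => x * v).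
Proof.
move=> x; have oT : open [set: quat R] by exact: openT.
have C : Ck 0 [set: quat R] (fun x : quat R => x * v).
  by apply: Ck_qmul => //; [exact: (@Ck_id R 0 1 4 setT)|exact: Ck_cst].
exact: Ck_continuous C I.
Qed.

(** If f has no expansion then neither has its product with the unit v, and both
    sides are the default value 0 of [coefs]. *)
Lemma coefs_mulr (f : quat R -> quat R) (v : quat R) : v != 0 ->
  coefs (fun q => f q * v) = fun n => coefs f n * v.
Proof.
have mul (g : quat R -> quat R) w a : (forall q, qball q ->
  series (fun n => q ^+ n * a n) @ \oo --> g q) ->
    forall q, qball q -> series (fun n => q ^+ n * (a n * w)) @ \oo --> g q * w.
  move=> ga q qB; have -> : series (fun n => q ^+ n * (a n * w)) =
      (fun x => x * w) \o series (fun n => q ^+ n * a n).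
    apply/funext => N; rewrite /series/= mulr_suml.
    by apply: eq_bigr => k _; rewrite mulrA.
  by apply: cvg_comp (ga _ qB) _; exact: qmulr_continuous.
move=> v0; rewrite [in RHS]/coefs; case: xgetP => [a _ fa|nf].
  by apply: coefs_eq; exact: mul.
rewrite /coefs; case: xgetP => [b _ fb|_]; last by apply/funext => n;
  rewrite mul0r.
case: (nf (fun n => b n * v^-1)) => q qB.
have := mul _ v^-1 _ fb q qB; rewrite -mulrA qmulV// mulr1; exact.
Qed.

Lemma lmap_coefs (c d : quat R) : coefs (lmap c d) = fun n => nth 0 [:: d; c] n.
Proof.
apply: coefs_eq => q _.
have -> : lmap c d q = d + q * c + q ^+ 2 * 0 by rewrite mulr0 addr0 addrC.
by apply: (@powser3_cvg (fun n => nth 0 [:: d; c] n)).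
Qed.

Lemma lmap_regconj (c d q : quat R) : qball q ->
  regconj (lmap c d) q = q * qconj c + qconj d.
Proof.
move=> qB; rewrite /regconj lmap_coefs powser3E//=.
  by rewrite qconj0 mulr0 addr0 addrC.
by move=> n; rewrite /= ?nth_nil qconj0.
Qed.

Lemma lmap_regconj_out (c d q : quat R) : ~ qball q -> regconj (lmap c d) q = 0.
Proof. by move=> qB; rewrite /regconj /powser memNset. Qed.

Lemma lmap_regconj_coefs (c d : quat R) :
  coefs (regconj (lmap c d)) = fun n => nth 0 [:: qconj d; qconj c] n.
Proof.
apply: coefs_eq => q qB; rewrite lmap_regconj//.
have -> : q * qconj c + qconj d = qconj d + q * qconj c + q ^+ 2 * 0.
  by rewrite mulr0 addr0 addrC.
by apply: (@powser3_cvg (fun n => nth 0 [:: qconj d; qconj c] n)).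
Qed.

Lemma lmap_symmetrization (c d q : quat R) : qball q ->
  symmetrization (lmap c d) q =
  d * qconj d + q * (d * qconj c + c * qconj d) + q ^+ 2 * (c * qconj c).
Proof.
move=> qB; rewrite /symmetrization /star lmap_coefs lmap_regconj_coefs.
rewrite powser3E// => [|n].
  by rewrite !big_ord_recl !big_ord0 /= !addr0 mulr0 mul0r !addr0 add0r.
rewrite big1// => -[[|[|k]] /= kn] _; rewrite ?subSS ?subn0 ?nth_nil ?mulr0//.
by rewrite mul0r.
Qed.

Lemma star_recip_lmap (c d q : quat R) : qball q -> star_recip (lmap c d) q =
  (d * qconj d + q * (d * qconj c + c * qconj d) + q ^+ 2 * (c * qconj c))^-1 *
  (q * qconj c + qconj d).
Proof. by move=> qB; rewrite /star_recip lmap_regconj// lmap_symmetrization.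
  Qed.

Lemma star_recip_lmap_out (c d q : quat R) : ~ qball q ->
  star_recip (lmap c d) q = 0.
Proof. by move=> qB; rewrite /star_recip lmap_regconj_out// mulr0. Qed.

(** The symmetrization has real coefficients, so it is only scaled by the
    squared norm of w, while the regular conjugate picks up conj w on the right. *)
Lemma star_recip_lmap_mull (w c d : quat R) : w != 0 ->
  star_recip (lmap (w * c) (w * d)) = fun q => star_recip (lmap c d) q * w^-1.
Proof.
move=> w0; apply/funext => q.
have [qB|qB] := pselect (qball q); last first.
  apply: etrans (star_recip_lmap_out _ _ qB) _.
  by rewrite star_recip_lmap_out// mul0r.
apply: etrans (star_recip_lmap _ _ qB) _; rewrite star_recip_lmap//.
set S := (X in _ = X^-1 * _ * _).
have SE : w * d * qconj (w * d) + q * (w * d * qconj (w * c) + w * c * qconj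
  (w * d)) +
    q ^+ 2 * (w * c * qconj (w * c)) = (qnorm w ^+ 2) *: S.
  have real x y : exists r : R, x * qconj y + y * qconj x = r *: (1 : quat R).
    exists (2 * (qc x 0 * qc y 0 + qc x 1 * qc y 1 + qc x 2 * qc y 2 +
      qc x 3 * qc y 3)).
    by quat_ring.
  have conjw x r : x = r *: (1 : quat R) -> w * x * qconj w = (qnorm w ^+ 2) *:
    x.
    move=> ->; rewrite qscaleAr mulr1 qscaleAl qmul_conj !scalerA.
    by rewrite mulrC.
  have sq x : w * x * qconj (w * x) = (qnorm w ^+ 2) *: (x * qconj x).
    by rewrite qconjM mulrA -[w * x * _]mulrA (conjw _ _ (qmul_conj x)).
  have cross x y : w * x * qconj (w * y) + w * y * qconj (w * x) =
      (qnorm w ^+ 2) *: (x * qconj y + y * qconj x).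
    have [r xy] := real x y; rewrite -(conjw _ _ xy) !qconjM !mulrA -mulrDl.
    by rewrite mulrDr !mulrA.
  by rewrite cross !sq !qscaleAr -!scalerDr.
rewrite SE qinvZ (qinvE w) !qconjM qscaleAl qscaleAr; congr (_ *: _).
by rewrite -mulrA mulrDl !mulrA.
Qed.

Lemma star_lmap (f : quat R -> quat R) (a b : quat R) : star f (lmap a b) =
  powser (fun n => \sum_(k < n.+1) coefs f k * nth 0 [:: b; a] (n - k)%N).
Proof. by rewrite /star lmap_coefs. Qed.

(** The coefficients of the reciprocal acquire w^-1 on the right, next to the
    factor w of the other coefficients in the convolution. *)
Lemma star_quotient_mull (w a b c d : quat R) : w != 0 ->
  star (star_recip (lmap (w * c) (w * d))) (lmap (w * a) (w * b)) =
  star (star_recip (lmap c d)) (lmap a b).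
Proof.
move=> w0; have wV : w^-1 != 0.
  by apply/eqP => wV0; have := qmulV w0; rewrite wV0 mulr0 => /eqP;
    rewrite eq_sym oner_eq0.
have cancel (F G : nat -> quat R) : G = (fun n => F n * w^-1) ->
    powser (fun n => \sum_(k < n.+1) G k * nth 0 [:: w * b; w * a] (n - k)%N) =
    powser (fun n => \sum_(k < n.+1) F k * nth 0 [:: b; a] (n - k)%N).
  move=> ->; congr powser; apply/funext => n; apply: eq_bigr => k _.
  rewrite -mulrA; congr (_ * _).
  by case: (n - k)%N => [|[|m]] /=; rewrite ?nth_nil ?mulr0// mulrA qVmul//
    mul1r.
have cE : coefs (star_recip (lmap (w * c) (w * d))) =
    fun n => coefs (star_recip (lmap c d)) n * w^-1.
  by rewrite star_recip_lmap_mull//; exact: coefs_mulr.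
apply: etrans (star_lmap _ _ _) _; apply: etrans _ (esym (star_lmap _ _ _)).
exact: cancel cE.
Qed.

End PowerSeries.

(** * The group Sp(1,1) and its Moebius transformations *)

Section Sp11Algebra.
Context {R : realType}.
Local Notation H := (quat R).
Implicit Types (A B : 'M[H]_2) (a u v : H).

Lemma mx2P A B : A 0 0 = B 0 0 -> A 0 1 = B 0 1 -> A 1 0 = B 1 0 ->
  A 1 1 = B 1 1 -> A = B.
Proof.
move=> e00 e01 e10 e11; apply/matrixP => i j.
have o2 (k : 'I_2) : k = 0 \/ k = 1.
  by case: k => -[|[|//]] k2; [left|right]; exact/val_inj.
by case: (o2 i) => ->; case: (o2 j) => ->.
Qed.

Lemma sum2 (F : 'I_2 -> H) : \sum_i F i = F 0 + F 1.
Proof. by rewrite !big_ord_recl big_ord0 addr0; congr (_ + F _);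
  exact/val_inj. Qed.

Lemma mul2E A B i j : (A *m B) i j = A i 0 * B 0 j + A i 1 * B 1 j.
Proof. by rewrite mxE sum2. Qed.

Lemma mul_scalar2E A v i j : (A *m v%:M) i j = A i j * v.
Proof.
by rewrite mul2E !mxE; case: j => -[|[|//]] j2 /=;
  rewrite ?mulr0n ?mulr1n ?mulr0
  ?addr0 ?add0r; congr (A _ _ * _); exact/val_inj.
Qed.

Lemma adjI11E A i j : (adjoint A *m I11 *m A) i j =
  qconj (A 0 i) * A 0 j - qconj (A 1 i) * A 1 j.
Proof.
rewrite !mul2E !mxE /= !mulr0n !mulr1n !mulr0 addr0 add0r !mulr1.
by rewrite mulrN1 mulNr.
Qed.

Lemma qscale1_inj (r s : R) : r *: (1 : H) = s *: (1 : H) -> r = s.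
Proof. by move=> /(congr1 (fun q => qc q 0)); rewrite !qcE !mulr1. Qed.

Lemma Sp11P A : Sp11 A <->
  [/\ qnorm (A 0 0) ^+ 2 = 1 + qnorm (A 1 0) ^+ 2,
      qnorm (A 1 1) ^+ 2 = 1 + qnorm (A 0 1) ^+ 2 &
      qconj (A 0 0) * A 0 1 = qconj (A 1 0) * A 1 1].
Proof.
split=> [SA|[n0 n1 c01]].
  have E i j : qconj (A 0 i) * A 0 j - qconj (A 1 i) * A 1 j = I11 i j.
    by rewrite -adjI11E SA.
  have := E 0 0; have := E 1 1; have := E 0 1; rewrite !mxE /= !mulr0n !mulr1n.
  rewrite !qconj_mul -!scalerBl => c01 d1 d0; split.
  - have /qscale1_inj : (qnorm (A 0 0) ^+ 2 - qnorm (A 1 0) ^+ 2) *: (1 : H) =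
      1 *: (1 : H).
      by rewrite d0 scale1r.
    lra.
  - have /qscale1_inj : (qnorm (A 0 1) ^+ 2 - qnorm (A 1 1) ^+ 2) *: (1 : H) =
      (- 1) *: (1 : H).
      by rewrite d1 scaleN1r.
    lra.
  - by apply/eqP; rewrite -subr_eq0 c01.
rewrite /Sp11 /=; apply: mx2P; rewrite adjI11E !mxE /= ?mulr0n ?mulr1n.
- by rewrite !qconj_mul n0 -scalerBl addrK scale1r.
- by rewrite c01 subrr.
- apply: (can_inj (@qconjK R)); rewrite qconjD qconjN !qconjM !qconjK c01 subrr.
  by rewrite qconj0.
- by rewrite !qconj_mul n1 -scalerBl opprD addrCA subrr addr0 scaleN1r.
Qed.

Section Relations.
Context (A : 'M[H]_2) (SA : Sp11 A).

(** Take norms in the off-diagonal relation and eliminate the diagonal entries. *)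
Lemma Sp11_norm_offdiag : qnorm (A 0 1) ^+ 2 = qnorm (A 1 0) ^+ 2.
Proof.
have [n0 n1 c01] := (Sp11P A).1 SA.
have := congr1 (fun q => qnorm q ^+ 2) c01.
rewrite /= !qnormM !qnorm_conj !exprMn n0 n1; lra.
Qed.

Lemma Sp11_norm_diag : qnorm (A 0 0) ^+ 2 = qnorm (A 1 1) ^+ 2.
Proof.
by have [-> -> _] := (Sp11P A).1 SA; rewrite Sp11_norm_offdiag.
Qed.

Lemma Sp11_d_neq0 : A 1 1 != 0.
Proof.
have [_ n1 _] := (Sp11P A).1 SA; apply/eqP => d0.
by move: n1; rewrite d0 qnorm0 expr0n /= => /eqP; have :=
  sqr_ge0 (qnorm (A 0 1)); lra.
Qed.

Lemma Sp11_c : qnorm (A 1 1) ^+ 2 *: A 0 1 = A 0 0 * qconj (A 1 0) * A 1 1.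
Proof.
have [_ _ c01] := (Sp11P A).1 SA.
by rewrite -mulrA -c01 mulrA qmul_conj qscaleAl mul1r Sp11_norm_diag.
Qed.

Lemma Sp11_rows : A 0 0 * qconj (A 1 0) = A 0 1 * qconj (A 1 1).
Proof.
have := congr1 (fun q => q * qconj (A 1 1)) Sp11_c.
rewrite /= -[RHS]mulrA qmul_conj qscaleAr mulr1 qscaleAl.
by move=> /(scalerI (qnorm2_neq0 Sp11_d_neq0)) ->.
Qed.

(** The inverse is I A^* I. The defining relation makes it a left inverse; that
    it is also a right inverse amounts to [Sp11_norm_offdiag] and [Sp11_rows]. *)
Lemma Sp11_inv2 : inv2 A = \matrix_(i, j)
  (if i == 0 then if j == 0 then qconj (A 0 0) else - qconj (A 1 0)
   else if j == 0 then - qconj (A 0 1) else qconj (A 1 1)).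
Proof.
set B := (X in _ = X).
have [n0 n1 c01] := (Sp11P A).1 SA.
have AB : A *m B = 1%:M.
  apply: mx2P; rewrite mul2E !mxE /= ?mulr0n ?mulr1n ?mulrN.
  - by rewrite !qmul_conj n0 -Sp11_norm_offdiag -scalerBl addrK scale1r.
  - by rewrite addrC Sp11_rows subrr.
  - apply: (can_inj (@qconjK R)); rewrite qconjD qconjN !qconjM !qconjK
      Sp11_rows.
    by rewrite subrr qconj0.
  - by rewrite !qmul_conj n1 Sp11_norm_offdiag// scalerDl scale1r addrC addrK.
have BA : B *m A = 1%:M.
  apply: mx2P; rewrite mul2E !mxE /= ?mulr0n ?mulr1n ?mulNr.
  - by rewrite !qconj_mul n0 -scalerBl addrK scale1r.
  - by rewrite c01 subrr.
  - apply: (can_inj (@qconjK R)); rewrite qconjD qconjN !qconjM !qconjK c01.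
    by rewrite addrC subrr qconj0.
  - by rewrite !qconj_mul n1 scalerDl scale1r addrC addrK.
rewrite /inv2; case: xgetP => [B' _ [AB' B'A]|/(_ B) []//].
by rewrite -[B']mulmx1 -AB mulmxA B'A mul1mx.
Qed.

End Relations.

(** The parameters (a, u) of the Moebius map attached to the inverse of A. *)
Definition mob_param A : H * H :=
  (A 1 0 * (A 1 1)^-1, (qconj (A 1 1))^-1 * qconj (A 0 0)).

(** The factor normalising the matrix [[u, - conj a], [- a u, 1]] of phi (a, u). *)
Definition gamma a : R := (Num.sqrt (1 - qnorm a ^+ 2))^-1.

(** The matrix whose inverse is the normalised matrix of phi (a, u). *)
Definition mob_section (au : H * H) : 'M[H]_2 := \matrix_(i, j)
  (if i == 0
   then if j == 0 then gamma au.1 *: qconj au.2 else gamma au.1 *: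
     (qconj au.2 * qconj au.1)
   else if j == 0 then gamma au.1 *: au.1 else gamma au.1 *: (1 : H)).

Lemma gamma2 a : qball a -> gamma a ^+ 2 * (1 - qnorm a ^+ 2) = 1.
Proof.
move=> /qballP a1; rewrite /gamma exprVn sqr_sqrtr ?mulVf//;
  last by rewrite subr_ge0 ltW.
by rewrite gt_eqF// subr_gt0.
Qed.

Lemma gamma_gt0 a : qball a -> 0 < gamma a.
Proof. by move=> /qballP a1; rewrite invr_gt0 sqrtr_gt0 subr_gt0. Qed.

Lemma qconjV a : qconj a^-1 = (qconj a)^-1.
Proof. by rewrite !qinvE qconjZ qconjK qnorm_conj. Qed.

Lemma qnormV a : a != 0 -> qnorm a^-1 ^+ 2 = (qnorm a ^+ 2)^-1.
Proof.
move=> a0; apply: (mulfI (qnorm2_neq0 a0)).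
by rewrite -exprMn -qnormM qmulV// qnorm1 expr1n divff// qnorm2_neq0.
Qed.

Lemma qconj_neq0 a : a != 0 -> qconj a != 0.
Proof. by rewrite -!qnorm_eq0 qnorm_conj. Qed.

Lemma mob_sectionP au : qball au.1 -> Sp1 au.2 -> Sp11 (mob_section au).
Proof.
move=> aB /Sp1P uS; apply/Sp11P; rewrite !mxE /=; have := gamma2 aB.
rewrite !qnormZ !qnormM !qnorm_conj qnorm1 exprMn uS !expr1n !mulr1 mul1r.
move=> g2; split; [lra|lra|].
rewrite !qconjZ qconjK !qscaleAl !qscaleAr mulr1 !scalerA; congr (_ *: _).
by rewrite mulrA qmul_conj uS scale1r mul1r.
Qed.

Lemma mob_param_ball A : Sp11 A -> qball (mob_param A).1.
Proof.
move=> SA; have [n0 _ _] := (Sp11P A).1 SA; apply/qballP => /=.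
have d0 := Sp11_d_neq0 SA; have dn : 0 < qnorm (A 1 1) ^+ 2.
  by rewrite lt_def qnorm2_neq0// sqr_ge0.
rewrite qnormM exprMn qnormV// ltr_pdivrMr// mul1r.
by rewrite -(Sp11_norm_diag SA) n0 ltrDr.
Qed.

Lemma mob_param_Sp1 A : Sp11 A -> Sp1 (mob_param A).2.
Proof.
move=> SA; have d0 := Sp11_d_neq0 SA; apply/Sp1P => /=.
rewrite qnormM exprMn qnormV ?qconj_neq0// !qnorm_conj (Sp11_norm_diag SA).
by rewrite mulVf// qnorm2_neq0.
Qed.

Lemma mob_sectionK au : qball au.1 -> Sp1 au.2 -> mob_param (mob_section au) =
  au.
Proof.
case: au => a u /= aB uS; have g0 : gamma a != 0 by rewrite gt_eqF// gamma_gt0.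
rewrite /mob_param !mxE /= !qconjZ qconjK qconj1 !qinvZ invr1 !qscaleAl
  !qscaleAr.
by rewrite mulr1 mul1r !scalerA mulfV// mulVf// !scale1r.
Qed.

Lemma mob_param_coset A v : Sp11 A -> Sp1 v -> mob_param (A *m v%:M) = mob_param
  A.
Proof.
move=> SA vS; have d0 := Sp11_d_neq0 SA.
have v0 : v != 0 by rewrite -qnorm_eq0 vS oner_neq0.
rewrite /mob_param !mul_scalar2E !qconjM !invrM ?qunitE ?qconj_neq0//;
  congr pair.
  by rewrite mulrA -[A 1 0 * v * _]mulrA qmulV// mulr1.
by rewrite mulrA -[(qconj (A 1 1))^-1 * _ * _]mulrA qVmul ?mulr1// qconj_neq0.
Qed.

(** The inverse of A is conj d times the matrix of phi (a, u), and the factor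
    conj d cancels in the star quotient. *)
Lemma mobius_inv2 A : Sp11 A -> mobius (inv2 A) = phi (mob_param A).
Proof.
move=> SA; have d0 := qconj_neq0 (Sp11_d_neq0 SA).
have [e00 e01 e10 e11] : [/\ inv2 A 0 0 = qconj (A 0 0), inv2 A 0 1 = - qconj
  (A 1 0),
    inv2 A 1 0 = - qconj (A 0 1) & inv2 A 1 1 = qconj (A 1 1)].
  by rewrite Sp11_inv2// !mxE.
pose a := (mob_param A).1; pose u := (mob_param A).2.
have duE : qconj (A 1 1) * u = qconj (A 0 0).
  by rewrite /u /= mulrA qmulV// mul1r.
have dcE : qconj (A 1 1) * - qconj a = - qconj (A 1 0).
  by rewrite /a /= mulrN qconjM qconjV mulrA qmulV// mul1r.
have dbE : qconj (A 1 1) * - (a * u) = - qconj (A 0 1).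
  rewrite mulrN; congr (- _).
  have n0 := qnorm2_neq0 (Sp11_d_neq0 SA); apply: (scalerI n0).
  rewrite -qconjZ Sp11_c// !qconjM qconjK /a /u /=.
  rewrite !mulrA -qscaleAl; congr (_ * _).
  rewrite -!mulrA -invrM ?qunitE ?Sp11_d_neq0//.
  rewrite qconj_mul qinvZ invr1 qscaleAr mulr1 qscaleAr scalerA mulfV// scale1r.
  by [].
apply: etrans _ (star_quotient_mull u (- (a * u)) (- qconj a) 1 d0).
have eq_star (c d b e c' d' b' e' : H) : c = c' -> d = d' -> b = b' -> e = e' ->
    star (star_recip (lmap c d)) (lmap b e) = star (star_recip (lmap c' d'))
      (lmap b' e').
  by move=> -> -> -> ->.
apply: eq_star; [exact: etrans e01 (esym dcE)|exact: etrans e11 (esym (mulr1 _))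
  |exact: etrans e00 (esym duE)|exact: etrans e10 (esym dbE)].
Qed.

(** Modulo the section, the remaining factor in Sp(1) is d / |d|, as the section
    has a positive lower right entry. *)
Definition Sp11_split A : (H * H) * H :=
  (mob_param A, (qnorm (A 1 1))^-1 *: A 1 1).

Definition Sp11_join (w : (H * H) * H) : 'M[H]_2 := mob_section w.1 *m w.2%:M.

Lemma Sp11_joinE w i j : Sp11_join w i j = mob_section w.1 i j * w.2.
Proof. exact: mul_scalar2E. Qed.

Lemma Sp11_mul_Sp1 A v : Sp11 A -> Sp1 v -> Sp11 (A *m v%:M).
Proof.
move=> SA vS; have [n0 n1 c] := (Sp11P A).1 SA; apply/Sp11P.
rewrite !mul_scalar2E !qnormM vS !mulr1; split=> //.
by rewrite !qconjM -!mulrA [qconj (A 0 0) * _]mulrA c -mulrA.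
Qed.

Lemma Sp11_join_in w : qball w.1.1 -> Sp1 w.1.2 -> Sp1 w.2 ->
  Sp11 (Sp11_join w).
Proof. by move=> aB uS vS; apply: Sp11_mul_Sp1 => //; exact: mob_sectionP. Qed.

Lemma Sp11_split_Sp1 A : Sp11 A -> Sp1 (Sp11_split A).2.
Proof.
move=> /Sp11_d_neq0 d0; apply/Sp1P; rewrite /= qnormZ exprVn mulVf//.
exact: qnorm2_neq0.
Qed.

Lemma gamma_param A : Sp11 A -> gamma (mob_param A).1 = qnorm (A 1 1).
Proof.
move=> SA; have d0 := Sp11_d_neq0 SA; have g0 := gamma_gt0 (mob_param_ball SA).
have n0 := qnorm2_neq0 d0.
apply/eqP; rewrite -(@eqrXn2 _ 2)// ?qnorm_ge0//; last exact: ltW.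
have := gamma2 (mob_param_ball SA); rewrite /= qnormM exprMn qnormV//.
have [e0 e1 _] := (Sp11P A).1 SA; have := Sp11_norm_diag SA; rewrite e0.
move=> de; have -> : 1 - qnorm (A 1 0) ^+ 2 / qnorm (A 1 1) ^+ 2 =
  (qnorm (A 1 1) ^+ 2)^-1.
  by rewrite -[1](mulfV n0) -mulrBl -de addrK mul1r.
by move=> /(canRL (mulfK _)); rewrite invrK mul1r => ->//; rewrite invr_neq0.
Qed.

Lemma Sp11_splitK A : Sp11 A -> Sp11_join (Sp11_split A) = A.
Proof.
move=> SA; have d0 := Sp11_d_neq0 SA; have n0 : qnorm (A 1 1) != 0 by rewrite
  qnorm_eq0.
apply: mx2P; rewrite Sp11_joinE !mxE /= gamma_param// qscaleAl qscaleAr scalerA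
  mulfV// scale1r.
- by rewrite qconjM qconjK qconjV qconjK -mulrA qVmul// mulr1.
- rewrite !qconjM !qconjV !qconjK -!mulrA.
  apply: (scalerI (qnorm2_neq0 d0)); rewrite Sp11_c// -!mulrA -qscaleAr;
    congr (_ * _).
  rewrite [(A 1 1)^-1 * _]mulrA -invrM ?qunitE ?qconj_neq0// qconj_mul.
  by rewrite qinvZ invr1 qscaleAl mul1r scalerA mulfV ?scale1r// qnorm2_neq0.
- by rewrite -mulrA qVmul// mulr1.
- by rewrite mul1r.
Qed.

Lemma Sp11_joinK w : qball w.1.1 -> Sp1 w.1.2 -> Sp1 w.2 ->
  Sp11_split (Sp11_join w) = w.
Proof.
case: w => -[a u] v /= aB uS vS; have g0 := gamma_gt0 aB.
rewrite /Sp11_split mob_param_coset ?mob_sectionK//; last exact: mob_sectionP.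
rewrite Sp11_joinE !mxE /= qscaleAl mul1r.
have -> : qnorm (gamma a *: v) = gamma a.
  apply/eqP; rewrite -(@eqrXn2 _ 2)// ?qnorm_ge0// ?ltW//.
  by rewrite qnormZ vS expr1n mulr1.
by rewrite scalerA mulVf ?scale1r// gt_eqF.
Qed.

End Sp11Algebra.

(** * The ball and the group Sp(1) as manifolds *)

Section SmoothParametrisations.
Context {R : realType}.
Local Notation H := (quat R).
Local Notation Ckr k U f := (Ck k U (f : _ -> R)).
Local Notation idq := (id : H -> 'rV[R]_4).

Lemma open_pos (V : normedModType R) (f : V -> R) : Ck 0 setT f ->
  open [set x | 0 < f x].
Proof.
move=> Cf; have : open (setT `&` f @^-1` [set r | 0 < r]).
  apply: (@open_preimage_in R V R); [exact: openT| |exact: open_gt].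
  by move=> x _; exact: (Ck_continuous Cf).
by rewrite setTI.
Qed.

Section Components.
Context {V : normedModType R} (k : nat) (U : set V) (oU : open U).

Lemma Ck_qrow (f g : V -> H) : Ck k U f -> Ck k U g ->
  Ck k U (fun x => row_mx (f x : 'rV[R]_4) (g x : 'rV[R]_4)).
Proof. exact: (@Ck_row_mx R V k U 1 4 4). Qed.

Lemma Ck_qlsubmx n (f : V -> 'rV[R]_(4 + n)) : Ck k U f ->
  Ck k U ((fun x => lsubmx (f x)) : V -> H).
Proof. exact: (@Ck_lsubmx R V k U 1 4 n). Qed.

Lemma Ck_qrsubmx n (f : V -> 'rV[R]_(n + 4)) : Ck k U f ->
  Ck k U ((fun x => rsubmx (f x)) : V -> H).
Proof. exact: (@Ck_rsubmx R V k U 1 n 4). Qed.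

Lemma Ck_mx_coords (M : V -> 'M[H]_2) : (forall i j, Ck k U (fun x => M x i j))
  ->
  Ck k U (fun x => mx_coords (M x)).
Proof.
move=> CM; apply: (@Ck_row_mx R V k U 1 (4 + 4) (4 + 4)) => //.
  by apply: Ck_qrow; exact: CM.
by apply: Ck_qrow; exact: CM.
Qed.

Lemma Ck_gamma (f : V -> H) : (forall x, U x -> qball (f x)) -> Ck k U f ->
  Ckr k U (fun x => gamma (f x)).
Proof.
move=> fB Cf; have p x : U x -> 0 < 1 - qnorm (f x) ^+ 2.
  by move=> /fB/qballP; rewrite subr_gt0.
apply: CkV => //; first by move=> x Ux; rewrite gt_eqF// sqrtr_gt0 p.
by apply: Ck_sqrt => //; apply: CkB => //; [exact: Ck_cst|exact: Ck_qnorm2].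
Qed.

Lemma Ck_qnorm (f : V -> H) : (forall x, U x -> f x != 0) -> Ck k U f ->
  Ckr k U (fun x => qnorm (f x)).
Proof.
move=> f0 Cf; have p x : U x -> 0 < qnorm (f x) ^+ 2.
  by move=> /f0 fx; rewrite lt_def qnorm2_neq0// sqr_ge0.
have : Ckr k U (fun x => Num.sqrt (qnorm (f x) ^+ 2)).
  by apply: Ck_sqrt => //; exact: Ck_qnorm2.
by apply: eq_Ck => // x _; rewrite sqrtr_sqr ger0_norm// qnorm_ge0.
Qed.

Lemma Ck_mob_section (a u : V -> H) : (forall x, U x -> qball (a x)) ->
  Ck k U a -> Ck k U u -> forall i j, Ck k U (fun x => mob_section (a x, u x) i
    j).
Proof.
move=> aB Ca Cu i j; have Cg := Ck_gamma aB Ca.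
have E (q : V -> H) : (forall x, mob_section (a x, u x) i j = q x) ->
    Ck k U q -> Ck k U (fun x => mob_section (a x, u x) i j).
  by move=> e; apply: eq_Ck.
case: (boolP (i == 0)) E => i0; case: (boolP (j == 0)) => j0 E.
- apply: (E (fun x => gamma (a x) *: qconj (u x))) => [x|].
    by rewrite mxE i0 j0.
  by apply: Ck_qscale => //; exact: Ck_qconj.
- apply: (E (fun x => gamma (a x) *: (qconj (u x) * qconj (a x)))) => [x|].
    by rewrite mxE i0 (negbTE j0).
  by apply: Ck_qscale => //; apply: Ck_qmul => //; exact: Ck_qconj.
- apply: (E (fun x => gamma (a x) *: a x)) => [x|].
    by rewrite mxE (negbTE i0) j0.
  exact: Ck_qscale.
- apply: (E (fun x => gamma (a x) *: (1 : H))) => [x|].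
    by rewrite mxE (negbTE i0) (negbTE j0).
  by apply: Ck_qscale => //; exact: Ck_cst.
Qed.

End Components.

Lemma open_qball : open (qball : set H).
Proof.
have oT : open [set: H] by exact: openT.
have : open [set q : H | 0 < 1 - qnorm q ^+ 2].
  apply: open_pos; apply: CkB => //; first exact: Ck_cst.
  by apply: Ck_qnorm2 => //; exact: (@Ck_id R 0 1 4 setT).
rewrite (_ : [set _ | _] = qball)//; apply/seteqP; split=> q /=.
  by rewrite subr_gt0 => /qballP.
by move=> /qballP; rewrite subr_gt0.
Qed.

Lemma qball_embedded_atlas : embedded_atlas idq qball
  (qball_charts : set (chart R H 4)).
Proof.
split=> // q qB; exists (Chart qball idq idq) => //.
have im : cimage (Chart qball idq idq : chart R H 4) setT = qball.
  by apply/seteqP; split=> [_ [x [xB _] <-]//|x xB]; exists x.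
split=> //.
- by exists setT; [exact: openT|rewrite setIT].
- by rewrite im; exact: open_qball.
- by rewrite im => k; apply: (@Ck_id R k 1 4); exact: open_qball.
- move=> x _; exists setT, id; split=> //; first exact: openT.
  by move=> k; apply: Ck_id; exact: openT.
Qed.

(** Stereographic projection from -1: on the sphere the condition on the real
    part excludes that point only. *)
Definition stereo : chart R H 3 := Chart
  (Sp1 `&` [set u | 0 < 1 + qc u 0])
  (fun u => \row_(i < 3) ((1 + qc u 0)^-1 * qc u i.+1))
  (fun y => let n := y 0 0 ^+ 2 + y 0 1 ^+ 2 + y 0 2 ^+ 2 in
    mkquat ((1 - n) / (1 + n)) (2 * y 0 0 / (1 + n)) (2 * y 0 1 / (1 + n))
      (2 * y 0 2 / (1 + n))).

Lemma Sp1_coords (u : H) : Sp1 u <->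
  qc u 0 ^+ 2 + qc u 1 ^+ 2 + qc u 2 ^+ 2 + qc u 3 ^+ 2 = 1.
Proof. by rewrite Sp1P qnormE. Qed.

Lemma stereo_embedded : embedded_charts idq Sp1 3 stereo.
Proof.
have oT (V : normedModType R) : open [set: V] by exact: openT.
have n1 (a b c : R) : 1 + (a ^+ 2 + b ^+ 2 + c ^+ 2) != 0.
  by rewrite gt_eqF// ltr_pwDl// !addr_ge0// sqr_ge0.
have im : cimage stereo setT = setT.
  apply/seteqP; split=> // y _; exists (cinv stereo y).
    split=> //; split; rewrite /stereo /=.
      apply/Sp1_coords; rewrite !qc_mkquat.
      by have := n1 (y 0 0) (y 0 1) (y 0 2) => n0; field.
    rewrite !qc_mkquat; have n0 := n1 (y 0 0) (y 0 1) (y 0 2).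
    set n := _ + y 0 2 ^+ 2 in n0 *.
    have -> : 1 + (1 - n) / (1 + n) = 2 / (1 + n) by field.
    by rewrite divr_gt0// ltr_pwDl// !addr_ge0// sqr_ge0.
  rewrite /stereo /=; apply/rowP => i; rewrite mxE !qc_mkquat.
  have n0 := n1 (y 0 0) (y 0 1) (y 0 2); set n := _ + y 0 2 ^+ 2 in n0 *.
  have e : (1 + (1 - n) / (1 + n))^-1 = (1 + n) / 2.
    by rewrite -[RHS]invf_div; congr (_^-1); field.
  rewrite e; case: i => -[|[|[|//]]] i3; rewrite !qc_mkquat.
  - have -> : Ordinal i3 = 0 by exact/val_inj.
    by field.
  - have -> : Ordinal i3 = 1 by exact/val_inj.
    by field.
  - have -> : Ordinal i3 = 2 by exact/val_inj.
    by field.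
have Cd k (U : set H) : open U -> Ckr k U (fun u => 1 + qc u 0).
  move=> oU; apply: CkD => //; first exact: Ck_cst.
  by apply: Ck_qc => //; exact: (@Ck_id R k 1 4).
have oD : open [set u : H | 0 < 1 + qc u 0] by apply: open_pos; apply: Cd;
  exact: oT.
split.
- by exists [set u : H | 0 < 1 + qc u 0].
- by rewrite im; exact: oT.
- move=> u; rewrite inE => -[/Sp1_coords uS /= u0].
  have d0 : 1 + qc u 0 != 0 by rewrite gt_eqF.
  have e i (i3 : (i < 3)%N) : (\row_(i < 3) ((1 + qc u 0)^-1 * qc u i.+1)) 0
    (Ordinal i3)
      = (1 + qc u 0)^-1 * qc u i.+1 by rewrite mxE.
  have -> : (\row_(i < 3) ((1 + qc u 0)^-1 * qc u i.+1)) 0 0 = (1 + qc u 0)^-1 *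
    qc u 1.
    by rewrite mxE.
  have -> : (\row_(i < 3) ((1 + qc u 0)^-1 * qc u i.+1)) 0 1 = (1 + qc u 0)^-1 *
    qc u 2.
    by rewrite mxE.
  have -> : (\row_(i < 3) ((1 + qc u 0)^-1 * qc u i.+1)) 0 2 = (1 + qc u 0)^-1 *
    qc u 3.
    by rewrite mxE.
  set n := _ + _ + _.
  have nE : n = (1 - qc u 0) / (1 + qc u 0).
    have -> : n = (qc u 1 ^+ 2 + qc u 2 ^+ 2 + qc u 3 ^+ 2) / (1 + qc u 0) ^+ 2.
      by rewrite /n; field.
    have -> : qc u 1 ^+ 2 + qc u 2 ^+ 2 + qc u 3 ^+ 2 = (1 - qc u 0) *
      (1 + qc u 0).
      by move: uS => /(canRL (addrK _)); lra.
    by field.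
  have nE1 : 1 + n = 2 / (1 + qc u 0) by rewrite nE; field.
  have nE2 : 1 - n = 2 * qc u 0 / (1 + qc u 0) by rewrite nE; field.
  by apply: quatP; rewrite !qc_mkquat ?nE2 nE1; field.
- rewrite im => k; have oU := oT 'rV[R]_3.
  have Cy j : Ckr k [set: 'rV[R]_3] (fun y => y 0 j) by exact: Ck_coord.
  have Cyy j := CkM oU (Cy j) (Cy j).
  have Cn : Ckr k [set: 'rV[R]_3] (fun y => y 0 0 ^+ 2 + y 0 1 ^+ 2 + y 0 2 ^+
    2).
    have : Ckr k [set: 'rV[R]_3] (fun y => y 0 0 * y 0 0 + y 0 1 * y 0 1 +
      y 0 2 * y 0 2).
      by do ?apply: CkD => //.
    by apply: eq_Ck => // y _; rewrite !expr2.
  have C1 c : Ckr k [set: 'rV[R]_3] (fun=> c) by exact: Ck_cst.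
  have CV : Ckr k [set: 'rV[R]_3]
      (fun y => (1 + (y 0 0 ^+ 2 + y 0 1 ^+ 2 + y 0 2 ^+ 2))^-1).
    by apply: CkV => //; exact: CkD.
  have C2 j := CkM oU (CkM oU (C1 2) (Cy j)) CV.
  have C := Ck_mkquat oU (CkM oU (CkB oU (C1 1) Cn) CV) (C2 0) (C2 1) (C2 2).
  have {}C : Ck k setT (cinv stereo : 'rV[R]_3 -> H) by exact: C.
  exact: C.
- move=> u [_ u0]; exists [set u : H | 0 < 1 + qc u 0].
  exists (fun u : H => \row_(i < 3) ((1 + qc u 0)^-1 * qc u i.+1)); split=> //.
  move=> k; apply: (Ck_mxP k _ oD).2 => i j.
  have : Ckr k [set u : H | 0 < 1 + qc u 0] (fun u =>
    (1 + qc u 0)^-1 * qc u j.+1).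
    apply: CkM => //.
      apply: CkV => //; last exact: Cd.
      by move=> x /= x0; rewrite gt_eqF.
    by apply: Ck_qc => //; exact: (@Ck_id R k 1 4).
  by apply: eq_Ck => // x _; rewrite mxE.
Qed.

(** Left translation by conj p brings p to 1, where the stereographic projection
    is defined. *)
Lemma Sp1_embedded_atlas : embedded_atlas idq Sp1
  (Sp1_charts : set (chart R H 3)).
Proof.
split=> // p pS; have oT : open [set: H] by exact: openT.
have mulS (q : H) : ambient_smooth idq Sp1 idq (fun u => q * u).
  exists setT, (fun u : H => q * u); split=> // k.
  by apply: Ck_qmul => //; [exact: Ck_cst|exact: (@Ck_id R k 1 4)].
exists (Chart (Sp1 `&` (fun u => qconj p * u) @^-1` cdom stereo)
    (cmap stereo \o (fun u => qconj p * u)) ((fun u => p * u) \o cinv stereo)).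
  apply: (embedded_chart_pullback (T := Sp1) stereo_embedded) => //.
  - by move=> u uS; apply: Sp1_mul => //; exact: Sp1_conj.
  - by move=> u uS; exact: Sp1_mul.
  - by move=> u _; rewrite mulrA Sp1_mulV// mul1r.
  - by move=> u _; rewrite mulrA Sp1_Vmul// mul1r.
split=> //=; rewrite Sp1_Vmul//; split; first exact: Sp1_1.
by rewrite /= qc1.
Qed.

End SmoothParametrisations.

(** * Sp(1,1) as a manifold *)

Section Sp11Manifold.
Context {R : realType}.
Local Notation H := (quat R).
Local Notation Ckr k U f := (Ck k U (f : _ -> R)).
Local Notation idq := (id : H -> 'rV[R]_4).
Local Notation pairq := (prod_emb idq idq).
Local Notation tripleq := (prod_emb pairq idq).

Definition coord00 (z : 'rV[R]_((4 + 4) + (4 + 4))) : H := lsubmx (lsubmx z).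
Definition coord10 (z : 'rV[R]_((4 + 4) + (4 + 4))) : H := lsubmx (rsubmx z).
Definition coord11 (z : 'rV[R]_((4 + 4) + (4 + 4))) : H := rsubmx (rsubmx z).

Lemma coordE (A : 'M[H]_2) : [/\ coord00 (mx_coords A) = A 0 0,
  coord10 (mx_coords A) = A 1 0 & coord11 (mx_coords A) = A 1 1].
Proof.
by rewrite /coord00 /coord10 /coord11 /mx_coords !(row_mxKl, row_mxKr).
Qed.

Section CoordSmooth.
Context (k : nat) (U : set 'rV[R]_((4 + 4) + (4 + 4))) (oU : open U).

Lemma Ck_coord00 : Ck k U coord00.
Proof.
apply: (@Ck_qlsubmx R _ k U oU 4); apply: (@Ck_lsubmx R _ k U 1 (4 + 4) (4 + 4))
  => //.
exact: Ck_id.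
Qed.

Lemma Ck_coord10 : Ck k U coord10.
Proof.
apply: (@Ck_qlsubmx R _ k U oU 4); apply: (@Ck_rsubmx R _ k U 1 (4 + 4) (4 + 4))
  => //.
exact: Ck_id.
Qed.

Lemma Ck_coord11 : Ck k U coord11.
Proof.
apply: (@Ck_qrsubmx R _ k U oU 4); apply: (@Ck_rsubmx R _ k U 1 (4 + 4) (4 + 4))
  => //.
exact: Ck_id.
Qed.

End CoordSmooth.

(** Matrices with an invertible lower right entry, where the parameters are
    given by rational expressions. *)
Definition regular11 : set 'rV[R]_((4 + 4) + (4 + 4)) :=
  [set z | 0 < qnorm (coord11 z) ^+ 2].

Lemma open_regular11 : open regular11.
Proof.
by apply: open_pos; apply: Ck_qnorm2; [|apply: Ck_coord11]; exact: openT.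
Qed.

Lemma regular11_neq0 z : regular11 z -> coord11 z != 0.
Proof.
by rewrite /regular11 /= => z0; apply/eqP => d0; rewrite d0 qnorm0 expr0n ltxx
  in z0.
Qed.

Lemma Sp11_regular A : Sp11 A -> regular11 (mx_coords A).
Proof.
move=> /Sp11_d_neq0 d0; rewrite /regular11 /=; have [_ _ ->] := coordE A.
by rewrite lt_def qnorm2_neq0// sqr_ge0.
Qed.

Lemma Ck_param k : Ck k regular11 (fun z =>
  row_mx (coord10 z * (coord11 z)^-1 : 'rV[R]_4)
    ((qconj (coord11 z))^-1 * qconj (coord00 z) : 'rV[R]_4)).
Proof.
have oU := open_regular11.
apply: Ck_qrow => //; apply: Ck_qmul => //.
- exact: Ck_coord10.
- by apply: Ck_qinv => //; [exact: regular11_neq0|exact: Ck_coord11].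
- apply: Ck_qinv => //; first by move=> z /regular11_neq0; exact: qconj_neq0.
  by apply: Ck_qconj => //; exact: Ck_coord11.
- by apply: Ck_qconj => //; exact: Ck_coord00.
Qed.

Lemma mob_param_smooth : ambient_smooth mx_coords Sp11 pairq mob_param.
Proof.
exists regular11, (fun z =>
  row_mx (coord10 z * (coord11 z)^-1 : 'rV[R]_4)
    ((qconj (coord11 z))^-1 * qconj (coord00 z) : 'rV[R]_4)).
split; [exact: open_regular11|exact: Sp11_regular|exact: Ck_param|].
by move=> A _; have [-> -> ->] := coordE A.
Qed.

Lemma Sp11_split_smooth : ambient_smooth mx_coords Sp11 tripleq Sp11_split.
Proof.
have oU := open_regular11.
exists regular11, (fun z =>
  row_mx (row_mx (coord10 z * (coord11 z)^-1 : 'rV[R]_4)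
    ((qconj (coord11 z))^-1 * qconj (coord00 z) : 'rV[R]_4))
    ((qnorm (coord11 z))^-1 *: coord11 z : 'rV[R]_4)).
split; [exact: open_regular11|exact: Sp11_regular| |].
- move=> k; apply: (@Ck_row_mx R _ k _ 1 (4 + 4) 4) => //;
    first exact: Ck_param.
  have C1 : Ck k regular11 coord11 by exact: Ck_coord11.
  have C : Ck k regular11 (fun z => (qnorm (coord11 z))^-1 *: coord11 z).
    apply: Ck_qscale => //; apply: CkV => //.
      by move=> z /regular11_neq0; rewrite qnorm_eq0.
    by apply: Ck_qnorm => //; exact: regular11_neq0.
  exact: C.
- by move=> A _; have [-> -> ->] := coordE A.
Qed.

Definition ball_cyl : set 'rV[R]_(4 + 4) := [set z | qball (lsubmx z : H)].

Lemma open_ball_cyl : open ball_cyl.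
Proof.
have := open_block open_qball (openT : open [set: 'rV[R]_4]).
by rewrite (_ : [set _ | _] = ball_cyl)//; apply/seteqP; split=> z //= [].
Qed.

Lemma mob_section_smooth :
  ambient_smooth pairq (qball `*` Sp1) mx_coords (mob_section : H * H ->
    'M[H]_2).
Proof.
have oU := open_ball_cyl.
exists ball_cyl, (fun z =>
  mx_coords (mob_section (lsubmx z : H, rsubmx z : H))).
split; first exact: oU.
- by move=> [a u] [/= aB _]; rewrite /ball_cyl /= /prod_emb row_mxKl.
- move=> k; apply: Ck_mx_coords => //; apply: Ck_mob_section => //.
    by apply: (@Ck_qlsubmx R _ k _ oU 4); exact: Ck_id.
  by apply: (@Ck_qrsubmx R _ k _ oU 4); exact: Ck_id.
- by move=> [a u] _; rewrite /prod_emb /= row_mxKl row_mxKr.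
Qed.

Lemma Sp11_join_smooth : ambient_smooth tripleq ((qball `*` Sp1) `*` Sp1)
  mx_coords
  (Sp11_join : _ -> 'M[H]_2).
Proof.
have := open_block open_ball_cyl (openT : open [set: 'rV[R]_4]).
set U := [set z | _] => oU.
exists U, (fun z => mx_coords (Sp11_join
  ((lsubmx (lsubmx z) : H, rsubmx (lsubmx z) : H), rsubmx z : H))).
split; first exact: oU.
- move=> [[a u] v] [[/= aB _] _]; split=> //.
  by rewrite /ball_cyl /= /prod_emb /= !row_mxKl.
- move=> k; apply: Ck_mx_coords => // i j.
  have Cl : Ck k U (lsubmx : 'rV[R]_((4 + 4) + 4) -> 'rV[R]_(4 + 4)).
    by apply: Ck_lsubmx => //; exact: Ck_id.
  have Cv : Ck k U (fun z : 'rV[R]_((4 + 4) + 4) => rsubmx z : H).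
    by apply: (@Ck_qrsubmx R _ k _ oU (4 + 4)); exact: Ck_id.
  have Cs : Ck k U (fun z : 'rV[R]_((4 + 4) + 4) =>
      mob_section (lsubmx (lsubmx z) : H, rsubmx (lsubmx z) : H) i j).
    apply: Ck_mob_section => //; first by move=> z [].
      exact: (@Ck_qlsubmx R _ k _ oU 4).
    exact: (@Ck_qrsubmx R _ k _ oU 4).
  have C := Ck_qmul oU Cs Cv.
  by apply: eq_Ck C => // z _; rewrite Sp11_joinE.
- by move=> [[a u] v] _; rewrite /prod_emb /= !row_mxKl !row_mxKr.
Qed.

Lemma ball_Sp1_atlas : embedded_atlas pairq (qball `*` Sp1)
  (prod_charts (@qball_charts R) (@Sp1_charts R)).
Proof. exact: prod_embedded_atlas qball_embedded_atlas Sp1_embedded_atlas. Qed.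

Lemma Sp11_embedded_atlas : embedded_atlas mx_coords Sp11 (@Sp11_charts R).
Proof.
split=> // A SA.
have [E cov] := prod_embedded_atlas ball_Sp1_atlas Sp1_embedded_atlas.
have splitT (B : 'M[H]_2) : Sp11 B -> ((qball `*` Sp1) `*` Sp1) (Sp11_split B).
  move=> SB; split; last exact: Sp11_split_Sp1.
  by split; [exact: mob_param_ball|exact: mob_param_Sp1].
have [d /E Ed dA] := cov _ (splitT _ SA).
exists (Chart (Sp11 `&` Sp11_split @^-1` cdom d) (cmap d \o Sp11_split)
    (Sp11_join \o cinv d)); last by split.
apply: (embedded_chart_pullback Ed) => //.
- by move=> [[a u] v] [[/= aB uS] vS]; exact: Sp11_join_in.
- exact: Sp11_splitK.
- by move=> [[a u] v] [[/= aB uS] vS]; exact: Sp11_joinK.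
- exact: Sp11_split_smooth.
- exact: Sp11_join_smooth.
Qed.

Definition ball_stretch (a : H) : H := gamma a *: a.
Definition ball_shrink (y : H) : H := (Num.sqrt (1 + qnorm y ^+ 2))^-1 *: y.

Lemma ball_shrink_in y : qball (ball_shrink y).
Proof.
have p : 0 < 1 + qnorm y ^+ 2 by rewrite ltr_pwDl// sqr_ge0.
apply/qballP; rewrite qnormZ exprVn sqr_sqrtr ?ltW// mulrC ltr_pdivrMr// mul1r.
by rewrite ltrDr.
Qed.

Lemma ball_stretchK a : qball a -> ball_shrink (ball_stretch a) = a.
Proof.
move=> aB; have g0 := gamma_gt0 aB; have g2 := gamma2 aB.
rewrite /ball_shrink /ball_stretch qnormZ.
have -> : 1 + gamma a ^+ 2 * qnorm a ^+ 2 = gamma a ^+ 2 by lra.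
by rewrite sqrtr_sqr gtr0_norm// scalerA mulVf ?scale1r// gt_eqF.
Qed.

Lemma ball_shrinkK y : ball_stretch (ball_shrink y) = y.
Proof.
have p : 0 < 1 + qnorm y ^+ 2 by rewrite ltr_pwDl// sqr_ge0.
have s0 : Num.sqrt (1 + qnorm y ^+ 2) != 0 by rewrite gt_eqF// sqrtr_gt0.
rewrite /ball_stretch /gamma qnormZ exprVn sqr_sqrtr ?ltW//.
have -> : 1 - (1 + qnorm y ^+ 2)^-1 * qnorm y ^+ 2 = (1 + qnorm y ^+ 2)^-1.
  by field; rewrite gt_eqF.
by rewrite sqrtrV ?ltW// invrK scalerA mulfV ?scale1r.
Qed.

Definition stretch2 (au : H * H) : 'rV[R]_4 * 'rV[R]_4 :=
  (ball_stretch au.1, au.2).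
Definition shrink2 (yu : 'rV[R]_4 * 'rV[R]_4) : H * H :=
  (ball_shrink yu.1, yu.2).

Lemma stretch2K au : qball au.1 -> shrink2 (stretch2 au) = au.
Proof. by case: au => a u /= aB; rewrite /shrink2 /stretch2 /= ball_stretchK.
  Qed.

Lemma shrink2K yu : stretch2 (shrink2 yu) = yu.
Proof. by case: yu => y u; rewrite /shrink2 /stretch2 /= ball_shrinkK. Qed.

Local Notation pairR := (prod_emb (id : 'rV[R]_4 -> 'rV[R]_4) (id : 'rV[R]_4 ->
  'rV[R]_4)).

Lemma stretch2_smooth : ambient_smooth pairq (qball `*` Sp1) pairR stretch2.
Proof.
have oU := open_ball_cyl.
exists ball_cyl, (fun z => row_mx (ball_stretch (lsubmx z) : 'rV[R]_4)
  (rsubmx z)).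
split=> //.
- by move=> [a u] [/= aB _]; rewrite /ball_cyl /= /prod_emb row_mxKl.
- move=> k; have Ci : Ck k ball_cyl (@id 'rV[R]_(4 + 4)) by exact: Ck_id.
  have Cl := @Ck_qlsubmx R _ k _ oU 4 _ Ci; have Cr := @Ck_qrsubmx R _ k _ oU 4
    _ Ci.
  have Cs : Ck k ball_cyl (fun z : 'rV[R]_(4 + 4) => ball_stretch (lsubmx z)).
    by apply: Ck_qscale => //; exact: (Ck_gamma oU (fun _ h => h) Cl).
  exact: Ck_qrow.
- by move=> [a u] _; rewrite /prod_emb /= row_mxKl row_mxKr.
Qed.

Lemma shrink2_smooth : ambient_smooth pairR (setT `*` sphere 3) pairq shrink2.
Proof.
have oU : open [set: 'rV[R]_(4 + 4)] by exact: openT.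
exists setT, (fun z => row_mx (ball_shrink (lsubmx z) : 'rV[R]_4) (rsubmx z)).
split=> //.
- move=> k; have Ci : Ck k setT (@id 'rV[R]_(4 + 4)) by exact: Ck_id.
  have Cl := @Ck_qlsubmx R _ k _ oU 4 _ Ci; have Cr := @Ck_qrsubmx R _ k _ oU 4
    _ Ci.
  have Cs : Ck k setT (fun z : 'rV[R]_(4 + 4) => ball_shrink (lsubmx z)).
    apply: Ck_qscale => //; apply: CkV => //.
      by move=> z _; rewrite gt_eqF// sqrtr_gt0 ltr_pwDl// sqr_ge0.
    apply: Ck_sqrt => //; first by move=> z _; rewrite ltr_pwDl// sqr_ge0.
    by apply: CkD => //; [exact: Ck_cst|exact: Ck_qnorm2].
  exact: Ck_qrow.
- by move=> [a u] _; rewrite /prod_emb /= row_mxKl row_mxKr.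
Qed.

Lemma sphere3_embedded_atlas :
  embedded_atlas (id : 'rV[R]_4 -> 'rV[R]_4) (sphere 3) (@sphere_charts R 3).
Proof.
have := Sp1_embedded_atlas (R := R); rewrite /Sp1_charts -sphere3E; exact.
Qed.

Lemma R4_sphere_atlas : embedded_atlas pairR (setT `*` sphere 3)
  (prod_charts (@Rn_charts R 4) (@sphere_charts R 3)).
Proof. exact: prod_embedded_atlas (Rn_embedded_atlas 4) sphere3_embedded_atlas.
  Qed.

End Sp11Manifold.

(** * The quotient of Sp(1,1) and the theorem *)

Section Quotient.
Context {R : realType}.
Local Notation H := (quat R).

Lemma coset_self (A : 'M[H]_2) : coset A A.
Proof. by exists 1; [exact: Sp1_1|rewrite mulmx1]. Qed.

Lemma xget_coset (A : 'M[H]_2) : exists2 v : H, Sp1 v & xget 0 (coset A) =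
  A *m v%:M.
Proof.
case: xgetP => [B _ [v vS <-]|/(_ A) []]; last exact: coset_self.
by exists v.
Qed.

(** Independent of the representative chosen by [xget], by [mob_param_coset]. *)
Definition quot_param (C : set 'M[H]_2) : H * H := mob_param (xget 0 C).

Lemma quot_param_coset (A : 'M[H]_2) : Sp11 A -> quot_param (coset A) =
  mob_param A.
Proof.
by move=> SA; have [v vS E] := xget_coset A;
  rewrite /quot_param E mob_param_coset.
Qed.

Lemma quot_to_Mob_coset (A : 'M[H]_2) : Sp11 A ->
  quot_to_Mob (coset A) = phi (mob_param A).
Proof.
move=> SA; have [v vS E] := xget_coset A.
rewrite /quot_to_Mob E mobius_inv2 ?mob_param_coset//.
exact: Sp11_mul_Sp1.
Qed.

Lemma quot_to_Mob_section (au : H * H) : qball au.1 -> Sp1 au.2 ->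
  quot_to_Mob (coset (mob_section au)) = phi au.
Proof.
by move=> aB uS; rewrite quot_to_Mob_coset ?mob_sectionK//; exact: mob_sectionP.
Qed.

End Quotient.

Theorem theorem4p1p7 (R : realType)
  (* the manifold structure of Sp(1,1)/Sp(1)I_2 *)
  (n : nat) (AQ : set (chart R (set 'M[quat R]_2) n))
  (mfldQ : is_manifold Sp11_quot AQ)
  (submQ : submersion Sp11 Sp11_charts Sp11_quot AQ coset)
  (* the manifold structure of M(B) *)
  (m : nat) (AM : set (chart R (quat R -> quat R) m))
  (mfldM : is_manifold MobB AM)
  (diffM : diffeomorphism Sp11_quot AQ MobB AM quot_to_Mob) :
  diffeomorphism (qball `*` Sp1) (prod_charts qball_charts Sp1_charts)
    MobB AM phi /\
  exists h : (quat R -> quat R) -> 'rV[R]_4 * 'rV[R]_4,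
    diffeomorphism MobB AM
      (setT `*` sphere 3) (prod_charts (Rn_charts 4) (sphere_charts 3)) h.
Proof.
have [aQ _ _] := mfldQ; have [aM _ _] := mfldM.
have [k [sq sk qK kK]] := diffM.
have EB := @ball_Sp1_atlas R; have aB := embedded_is_atlas EB.
have ES := @Sp11_embedded_atlas R; have aS := embedded_is_atlas ES.
have ER := @R4_sphere_atlas R; have aR := embedded_is_atlas ER.
have sc := submQ.1.
have cosetQ (A : 'M[quat R]_2) : Sp11 A -> Sp11_quot (coset A) by move=> SA;
  exists A.
have paramB (A : 'M[quat R]_2) : Sp11 A -> (qball `*` Sp1) (mob_param A).
  by move=> SA; split; [exact: mob_param_ball|exact: mob_param_Sp1].
have sphi : smooth_map (qball `*` Sp1) (prod_charts qball_charts Sp1_charts)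
  MobB AM phi.
  have ss := embedded_smooth_map EB ES _ (@mob_section_smooth R).
  have {}ss := ss (fun au auB => mob_sectionP auB.1 auB.2).
  have scomp := smooth_map_comp aB aQ aM (smooth_map_comp aB aS aQ ss sc) sq.
  have E (au : quat R * quat R) : (qball `*` Sp1) au ->
    quot_to_Mob (coset (mob_section au)) = phi au.
    by move=> [aub uS]; exact: quot_to_Mob_section.
  exact: (eq_smooth_map aB aM E scomp).
have squot : smooth_map Sp11_quot AQ (qball `*` Sp1)
    (prod_charts qball_charts Sp1_charts) quot_param.
  apply: (smooth_map_descent aS aQ aB submQ) => //.
  have sp := embedded_smooth_map ES EB paramB (@mob_param_smooth R).
  have E (A : 'M[quat R]_2) : Sp11 A -> mob_param A = quot_param (coset A).
    by move=> SA; rewrite quot_param_coset.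
  exact: (eq_smooth_map aS aB E sp).
have sinv := smooth_map_comp aM aQ aB sk squot.
have phiK : {in qball `*` Sp1, cancel phi (quot_param \o k)}.
  move=> au; rewrite inE => -[aub uS]; have Ss := mob_sectionP aub uS.
  rewrite -(quot_to_Mob_section aub uS) /= qK ?inE//; last exact: cosetQ.
  by rewrite quot_param_coset// mob_sectionK.
have invK : {in MobB, cancel (quot_param \o k) phi}.
  move=> F; rewrite inE => MF; have Qk : Sp11_quot (k F) by case: sk => + _ _;
    apply; exists F.
  have [A SA AE] := Qk.
  by rewrite /= -AE quot_param_coset// -quot_to_Mob_coset// AE kK// inE.
split; first by exists (quot_param \o k).
have sstretch := embedded_smooth_map EB ER _ (@stretch2_smooth R).
have sshrink := embedded_smooth_map ER EB _ (@shrink2_smooth R).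
exists (stretch2 \o (quot_param \o k)), (phi \o shrink2).
have stretchT au : (qball `*` Sp1) au -> (setT `*` sphere 3) (@stretch2 R au).
  by move=> [_ uS]; split=> //; rewrite sphere3E.
have shrinkB yu : (setT `*` sphere 3) yu -> (qball `*` Sp1) (@shrink2 R yu).
  by move=> [_ uS]; split; [exact: ball_shrink_in|rewrite -sphere3E].
have kB F : MobB F -> (qball `*` Sp1) ((quot_param \o k) F).
  by move=> MF; case: sinv => + _ _; apply; exists F.
split.
- exact: smooth_map_comp aM aB aR sinv (sstretch stretchT).
- exact: smooth_map_comp aR aB aM (sshrink shrinkB) sphi.
- move=> F; rewrite inE => MF; have [aub _] := kB F MF.
  apply: etrans (congr1 phi (stretch2K aub)) _.
  by apply: invK; rewrite inE.
- move=> yu; rewrite inE => yuS; have yuB := shrinkB _ yuS.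
  apply: etrans (congr1 (@stretch2 R) (phiK _ (mem_set yuB))) _.
  exact: shrink2K.
Qed.
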